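(* Let $\mathcal L$ be a Leibniz algebra over a field $k$ with product $\{,\}$. Let $\mathcal L_0$ be the subspace of $\mathcal L$ spanned by $\{\{a,a\},\ \{a,b\}+\{b,a\}\mid a,b\in\mathcal L\}$. Let $\{x_i\mid i\in I_0\}$ be a $k$-basis of $\mathcal L_0$ and $X=\{x_i\mid i\in I\}$ a well ordered $k$-basis of $\mathcal L$ with $I_0\subseteq I$ (order $I$ so that $i<j$ iff $x_i<x_j$). Let $U(\mathcal L)=D(X\mid x_i\dashv x_j-x_j\vdash x_i-\{x_i,x_j\},\ i,j\in I)$ be the universal enveloping dialgebra of $\mathcal L$, where $\{x_i,x_j\}$ is written as a linear combination of elements of $X$, and let $[X^*]$ carry the deg-lex ordering. Let $S\subset D(X)$ consist of the polynomials (a) $x_j\vdash x_i-x_i\dashv x_j+\{x_i,x_j\}$ ($i,j\in I$), (b) $x_j\vdash x_i\vdash x_t-x_i\vdash x_j\vdash x_t+\{x_i,x_j\}\vdash x_t$ ($i,j,t\in I$, $j>i$), (c) $x_{i_0}\vdash x_t$ ($i_0\in I_0$, $t\in I$), (d) $x_t\dashv x_j\dashv x_i-x_t\dashv x_i\dashv x_j+x_t\dashv\{x_i,x_j\}$ ($i,j,t\in I$, $j>i$), (e) $x_t\dashv x_{i_0}$ ($i_0\in I_0$, $t\in I$). Then: (i) $U(\mathcal L)=D(X|S)$, i.e. $S$ and the set of defining relations of $U(\mathcal L)$ generate the same ideal of $D(X)$. (ii) $S$ is a Gröbner–Shirshov basis in $D(X)$. (iii) The set $$\{x_j\dashv x_{i_1}\dashv\cdots\dashv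 x_{i_r}\mid j\in I,\ r\ge0,\ i_p\in I\setminus I_0\ (1\le p\le r),\ i_1\le\cdots\le i_r\}$$ is a $k$-linear basis of $U(\mathcal L)$. In particular, $\mathcal L$ is a Leibniz subalgebra of $U(\mathcal L)$ (i.e. the canonical map $\mathcal L\to U(\mathcal L)$, $x_i\mapsto x_i$, is an injective homomorphism of Leibniz algebras, $U(\mathcal L)$ having the bracket $[a,b]=a\dashv b-b\vdash a$).
   Context: Leibniz algebras. A Leibniz algebra is a $k$-vector space $L$ with a bilinear product $[,]$ satisfying $[[a,b],c]=[[a,c],b]+[a,[b,c]]$. If $D$ is a dialgebra then $D$ with $[a,b]=a\dashv b-b\vdash a$ is a Leibniz algebra $D^{(-)}$. The universal enveloping dialgebra of $L$ is a dialgebra $U(L)$ with a Leibniz homomorphism $L\to U(L)^{(-)}$ through which every Leibniz homomorphism from $L$ to $D^{(-)}$, $D$ a dialgebra, factors by a unique dialgebra homomorphism $U(L)\to D$; it is given by the presentation in the statement. Dialgebras. A dialgebra over a field $k$ is a $k$-vector space $D$ with two bilinear associative products $\vdash,\dashv$ such that $a\dashv(b\vdash c)=a\dashv b\dashv c$, $(a\dashv b)\vdash c=a\vdash b\vdash c$, $a\vdash(b\dashv c)=(a\vdash b)\dashv c$ for all $a,b,c$. An ideal is a subspace closed under left and right multiplication by arbitrary elements for both products; $Id(S)$ is the ideal generated by $S$, and $D(X|S)=D(X)/Id(S)$. Free dialgebra. $X^*$ is the free monoid on $X$. The free dialgebra $D(X)$ has as $k$-basis the set $[X^*]$ of normal diwords,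 i.e. nonempty words with one marked letter (the center), $[u]=x_{-m}\cdots x_{-1}\dot{x_0}x_1\cdots x_n$ ($m,n\ge 0$, $x_i\in X$), which stands for $x_{-m}\vdash\cdots\vdash x_{-1}\vdash x_0\dashv x_1\dashv\cdots\dashv x_n$. $[u]\vdash[v]$ is the concatenation $uv$ with the center of $[v]$, and $[u]\dashv[v]$ is $uv$ with the center of $[u]$. $|[u]|=m+n+1$ is the length. Ordering. $wt([u])=(n+m+1,m,x_{-m},\ldots,x_0,\ldots,x_n)$, and $[u]<[v]$ iff $wt([u])<wt([v])$ lexicographically (deg-lex ordering). For $0\ne f\in D(X)$, $[\overline f]$ is the largest normal diword occurring in $f$ with nonzero coefficient (the leading term), $\overline f$ its underlying word, and $deg(f)=|[\overline f]|$; $f$ is monic if the coefficient of $[\overline f]$ is $1$. A polynomial $f$ is left normed if all normal diwords occurring in it have the form $u\dot x$ (center is the last letter), right normed if all have the form $\dot x u$ (center is the first letter), $u\in X^*$, $x\in X$. $s$-diwords. For a nonzero $s\in D(X)$, an $s$-diword is $[asb]=x_{-m}\vdash\cdots\vdash x_{-1}\vdash x_0\dashv x_1\dashv\cdots\dashv x_n|_{x_p\mapsto s}$ for some $m,n\ge0$, $-m\le p\le n$, $x_i\in X$, where $a=x_{-m}\cdots x_{p-1}$ and $b=x_{p+1}\cdots x_n$ (possibly empty); the notation $[asb]$ includes the choice of the position $0$ of the center. $[a[\overline s]b]$ denotes the normal diword obtained by the same expression with $s$ replaced by $[\overline s]$. $[asb]$ is a normal $s$-diword if $p=0$, or $p<0$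 and $s$ is left normed, or $p>0$ and $s$ is right normed. A normal $s$-diword $[asb]$ is a left (right) normed $s$-diword if both $s$ and the polynomial $[asb]$ are left (right) normed. An $S$-diword is an $s$-diword with $s\in S$. Compositions of monic $f,g\in D(X)$. (1) If $f$ is not right normed and $x\in X$, $x\dashv f$ is a composition of left multiplication; if $f$ is not left normed and $x\in X$, $f\vdash x$ is a composition of right multiplication. (2) Inclusion: if $[w]=[\overline f]=[a[\overline g]b]$ with $[agb]$ a normal $g$-diword, $(f,g)_{[w]}=f-[agb]$. (3) Intersection: if $[w]=[[\overline f]b]=[a[\overline g]]$ with $|\overline f|+|\overline g|>|w|$, $[fb]$ a normal $f$-diword and $[ag]$ a normal $g$-diword, $(f,g)_{[w]}=[fb]-[ag]$. Triviality. For a set $S$ of monic polynomials: $x\dashv f$ (resp. $f\vdash x$) is trivial modulo $S$ if it equals a finite sum $\sum\alpha_i[a_is_ib_i]$ with $\alpha_i\in k$, $s_i\in S$, each $[a_is_ib_i]$ a right normed (resp. left normed) $s_i$-diword and $|[a_i[\overline{s_i}]b_i]|\le deg(x\dashv f)$ (resp. $\le deg(f\vdash x)$); the zero composition is trivial (empty sum). $(f,g)_{[w]}$ is trivial modulo $(S,[w])$ if it equals a finite sum $\sum\alpha_i[a_is_ib_i]$ with $\alpha_i\in k$, $s_i\in S$, each $[a_is_ib_i]$ a normal $s_i$-diword with $[a_i[\overline{s_i}]b_i]<[w]$, and moreover each $[a_is_ib_i]$ is a right (left) normed $s_i$-diword whenever both $f$ and $[agb]$ (inclusion case), or both $[fb]$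 and $[ag]$ (intersection case), are right (left) normed $S$-diwords. $S$ is a Gröbner–Shirshov basis in $D(X)$ if all compositions of elements of $S$ are trivial. *)

(* Defs.v *)
From HB Require Import structures.
From mathcomp Require Import all_boot all_order all_algebra finmap.
From mathcomp Require Import ring_quotient generic_quotient.
From mathcomp.multinomials Require Import monalg.
From mathcomp Require Import boolp classical_sets wochoice.

Set Implicit Arguments.
Unset Strict Implicit.
Unset Printing Implicit Defensive.

Import Order.TTheory GRing.Theory.
Local Open Scope ring_scope.
Local Open Scope classical_set_scope.

Reserved Notation "a ⊢ b" (at level 40, left associativity).
Reserved Notation "a ⊣ b" (at level 40, left associativity).

(* Finitely supported families of scalars indexed by [J] are elements of
   [{malg k[J]}]. *)
Section Bases.
Context {k : fieldType} {V : lmodType k} {J : choiceType}.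

Definition lincomb (e : J -> V) (c : {malg k[J]}) : V :=
  \sum_(j <- msupp c) c@_j *: e j.

Definition lin_span (A : set J) (e : J -> V) : set V :=
  [set lincomb e c | c in [set c | forall j, j \in msupp c -> A j]].

Definition lin_indep (A : set J) (e : J -> V) : Prop :=
  forall c : {malg k[J]}, (forall j, j \in msupp c -> A j) ->
    lincomb e c = 0 -> c = 0.

(* The family of the [e j], [j] in [A], is a basis of the subspace [W]. *)
Definition is_basis (A : set J) (e : J -> V) (W : set V) : Prop :=
  lin_indep A e /\ lin_span A e = W.

(* The coordinates of [v] in [e]; only meaningful when [e] is a basis. *)
Definition coords (e : J -> V) (v : V) : {malg k[J]} :=
  xget 0 [set c | lincomb e c = v].

End Bases.

HB.mixin Record Lmodule_isLeibniz (k : fieldType) (L : Type)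
    of GRing.Lmodule k L := {
  bracket : L -> L -> L;
  bracket_linearl : forall b, linear (bracket^~ b);
  bracket_linearr : forall a, linear (bracket a);
  leibniz_identity : forall a b c,
    bracket (bracket a b) c = bracket (bracket a c) b + bracket a (bracket b c)
}.

#[short(type="leibnizType")]
HB.structure Definition Leibniz (k : fieldType) :=
  {L of Lmodule_isLeibniz k L & GRing.Lmodule k L}.

Definition leibniz_morphism (k : fieldType) (L1 L2 : leibnizType k)
    (f : L1 -> L2) : Prop :=
  linear f /\ forall a b, f (bracket a b) = bracket (f a) (f b).

HB.mixin Record Lmodule_isDialgebra (k : fieldType) (D : Type)
    of GRing.Lmodule k D := {
  vdash : D -> D -> D;
  dashv : D -> D -> D;
  vdash_linearl : forall b, linear (vdash^~ b);
  vdash_linearr : forall a, linear (vdash a);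
  dashv_linearl : forall b, linear (dashv^~ b);
  dashv_linearr : forall a, linear (dashv a);
  vdashA : associative vdash;
  dashvA : associative dashv;
  dashv_vdash : forall a b c, dashv a (vdash b c) = dashv (dashv a b) c;
  vdash_dashv : forall a b c, vdash (dashv a b) c = vdash (vdash a b) c;
  vdash_dashvA : forall a b c, vdash a (dashv b c) = dashv (vdash a b) c
}.

#[short(type="dialgType")]
HB.structure Definition Dialgebra (k : fieldType) :=
  {D of Lmodule_isDialgebra k D & GRing.Lmodule k D}.

Notation "a ⊢ b" := (vdash a b) : ring_scope.
Notation "a ⊣ b" := (dashv a b) : ring_scope.

Section DialgebraTheory.
Context {k : fieldType} {D : dialgType k}.
Implicit Types a b c : D.

Lemma vdashDl a b c : (a + b) ⊢ c = a ⊢ c + b ⊢ c.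
Proof. by have := vdash_linearl c 1 a b; rewrite !scale1r. Qed.
Lemma vdashDr a b c : a ⊢ (b + c) = a ⊢ b + a ⊢ c.
Proof. by have := vdash_linearr a 1 b c; rewrite !scale1r. Qed.
Lemma dashvDl a b c : (a + b) ⊣ c = a ⊣ c + b ⊣ c.
Proof. by have := dashv_linearl c 1 a b; rewrite !scale1r. Qed.
Lemma dashvDr a b c : a ⊣ (b + c) = a ⊣ b + a ⊣ c.
Proof. by have := dashv_linearr a 1 b c; rewrite !scale1r. Qed.
Lemma vdash0l a : 0 ⊢ a = 0.
Proof. by apply: (addrI (0 ⊢ a)); rewrite -vdashDl !addr0. Qed.
Lemma vdash0r a : a ⊢ 0 = 0.
Proof. by apply: (addrI (a ⊢ 0)); rewrite -vdashDr !addr0. Qed.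
Lemma dashv0l a : 0 ⊣ a = 0.
Proof. by apply: (addrI (0 ⊣ a)); rewrite -dashvDl !addr0. Qed.
Lemma dashv0r a : a ⊣ 0 = 0.
Proof. by apply: (addrI (a ⊣ 0)); rewrite -dashvDr !addr0. Qed.
Lemma vdashNl a b : (- a) ⊢ b = - (a ⊢ b).
Proof. by apply: (addrI (a ⊢ b)); rewrite -vdashDl !subrr vdash0l. Qed.
Lemma vdashNr a b : a ⊢ (- b) = - (a ⊢ b).
Proof. by apply: (addrI (a ⊢ b)); rewrite -vdashDr !subrr vdash0r. Qed.
Lemma dashvNl a b : (- a) ⊣ b = - (a ⊣ b).
Proof. by apply: (addrI (a ⊣ b)); rewrite -dashvDl !subrr dashv0l. Qed.
Lemma dashvNr a b : a ⊣ (- b) = - (a ⊣ b).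
Proof. by apply: (addrI (a ⊣ b)); rewrite -dashvDr !subrr dashv0r. Qed.

Definition is_ideal (J : set D) : Prop :=
  [/\ J 0,
      forall (t : k) a b, J a -> J b -> J (t *: a + b)
    & forall a b, J a -> [/\ J (a ⊢ b), J (b ⊢ a), J (a ⊣ b) & J (b ⊣ a)]].

Definition Id (S : set D) : set D := smallest is_ideal S.

Lemma Id_ideal (S : set D) : is_ideal (Id S).
Proof.
split=> [J [[? _ _] _] //|t a b Ia Ib J IJ|a b Ia].
  by case: (IJ) => -[_ + _] _; apply; [apply: Ia | apply: Ib].
by split=> J IJ; case: (IJ) => -[_ _ /(_ a b (Ia J IJ))[]].
Qed.

End DialgebraTheory.

(* The Leibniz algebra D^(-). *)
Definition commutator_leibniz (D : Type) : Type := D.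

Section Commutator.
Context (k : fieldType) (D : dialgType k).
Local Notation Dm := (commutator_leibniz D).

HB.instance Definition _ := GRing.Lmodule.copy Dm D.

Definition dbracket (a b : Dm) : Dm := (a : D) ⊣ b - (b : D) ⊢ a.

Fact dbracket_linearl b : linear (dbracket^~ b).
Proof.
move=> t a a'; rewrite /dbracket dashv_linearl vdash_linearr opprD scalerBr.
by rewrite addrACA.
Qed.

Fact dbracket_linearr a : linear (dbracket a).
Proof.
move=> t b b'; rewrite /dbracket dashv_linearr vdash_linearl opprD scalerBr.
by rewrite addrACA.
Qed.

Fact dbracket_leibniz a b c :
  dbracket (dbracket a b) c = dbracket (dbracket a c) b + dbracket a (dbracket b c).
Proof.
have sum4 (V : zmodType) (p q r s t u : V) :
    p - q - (r - s) = t - r - (q - u) + (p - t - (u - s)).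
  rewrite !opprB [RHS]addrACA.
  have canc (x y z : V) : x - y + (z - x) = z - y by rewrite addrC addrA subrK.
  by rewrite !canc addrACA [RHS]addrACA [- q - r]addrC.
rewrite /dbracket.
rewrite !(dashvDl, dashvDr, vdashDl, vdashDr, dashvNl, dashvNr, vdashNl, vdashNr).
rewrite !(dashv_vdash, vdash_dashv, vdash_dashvA, dashvA, vdashA).
exact: sum4.
Qed.

HB.instance Definition _ := Lmodule_isLeibniz.Build k Dm
  dbracket_linearl dbracket_linearr dbracket_leibniz.

End Commutator.

Section Quotient.
Context {k : fieldType} {D : dialgType k}.
Implicit Type S : set D.
Local Open Scope quotient_scope.

Definition idealb S : {pred D} := fun f => `[< Id S f >].

Fact idealb_closed S : zmod_closed (idealb S).
Proof.
have [I0 IB _] := Id_ideal S; split; first exact/asboolP.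
move=> a b /asboolP Ia /asboolP Ib; apply/asboolP.
by rewrite addrC -scaleN1r; apply: IB.
Qed.

HB.instance Definition _ S :=
  GRing.isZmodClosed.Build D (idealb S) (idealb_closed S).

(* The dialgebra D / Id(S); its projection from D is [dialg_pi]. *)
Definition dialg_quot S : Type := Quotient.quot (idealb S).

HB.instance Definition _ S := GRing.Zmodule.on (dialg_quot S).

Definition dialg_pi S (a : D) : dialg_quot S := \pi_(Quotient.quot (idealb S)) a.

Fact dialg_piP S a b : dialg_pi S a = dialg_pi S b <-> Id S (a - b).
Proof.
rewrite /dialg_pi; split=> [/eqP|Iab].
  by rewrite -Quotient.idealrBE => /asboolP.
by apply/eqP; rewrite -Quotient.idealrBE; apply/asboolP.
Qed.

Definition dialg_repr S (q : dialg_quot S) : D := repr (q : Quotient.quot (idealb S)).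

Fact dialg_reprK S : cancel (@dialg_repr S) (dialg_pi S).
Proof. exact: reprK. Qed.

Fact dialg_repr_pi S a : Id S (dialg_repr (dialg_pi S a) - a).
Proof. by apply/dialg_piP; rewrite dialg_reprK. Qed.

Fact dialg_piD S : {morph dialg_pi S : a b / a + b}.
Proof. by move=> a b; rewrite /dialg_pi !piE. Qed.

Definition quot_scale S (t : k) (q : dialg_quot S) : dialg_quot S :=
  dialg_pi S (t *: dialg_repr q).
Definition quot_vdash S (p q : dialg_quot S) : dialg_quot S :=
  dialg_pi S (dialg_repr p ⊢ dialg_repr q).
Definition quot_dashv S (p q : dialg_quot S) : dialg_quot S :=
  dialg_pi S (dialg_repr p ⊣ dialg_repr q).

Fact quot_scaleE S t a : quot_scale t (dialg_pi S a) = dialg_pi S (t *: a).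
Proof.
apply/dialg_piP; rewrite -scalerBr -[_ *: _]addr0.
by have [I0 + _] := Id_ideal S; apply=> //; apply: dialg_repr_pi.
Qed.

Fact quot_vdashE S a b :
  quot_vdash (dialg_pi S a) (dialg_pi S b) = dialg_pi S (a ⊢ b).
Proof.
have [I0 IB IM] := Id_ideal S; apply/dialg_piP.
set a' := dialg_repr _; set b' := dialg_repr _.
have -> : a' ⊢ b' - a ⊢ b = 1 *: ((a' - a) ⊢ b') + a ⊢ (b' - b).
  by rewrite scale1r vdashDl vdashDr vdashNl vdashNr addrA subrK.
apply: IB; first by have [] := IM _ b' (dialg_repr_pi a).
by have [] := IM _ a (dialg_repr_pi b).
Qed.

Fact quot_dashvE S a b :
  quot_dashv (dialg_pi S a) (dialg_pi S b) = dialg_pi S (a ⊣ b).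
Proof.
have [I0 IB IM] := Id_ideal S; apply/dialg_piP.
set a' := dialg_repr _; set b' := dialg_repr _.
have -> : a' ⊣ b' - a ⊣ b = 1 *: ((a' - a) ⊣ b') + a ⊣ (b' - b).
  by rewrite scale1r dashvDl dashvDr dashvNl dashvNr addrA subrK.
apply: IB; first by have [] := IM _ b' (dialg_repr_pi a).
by have [] := IM _ a (dialg_repr_pi b).
Qed.

Fact quot_scaleA S t u (q : dialg_quot S) :
  quot_scale t (quot_scale u q) = quot_scale (t * u) q.
Proof. by rewrite -(dialg_reprK q) !quot_scaleE scalerA. Qed.

Fact quot_scale1 S : left_id 1 (@quot_scale S).
Proof. by move=> q; rewrite -(dialg_reprK q) quot_scaleE scale1r. Qed.

Fact quot_scaleDr S : right_distributive (@quot_scale S) +%R.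
Proof.
move=> t p q; rewrite -(dialg_reprK p) -(dialg_reprK q) -dialg_piD.
by rewrite !quot_scaleE -dialg_piD scalerDr.
Qed.

Fact quot_scaleDl S (q : dialg_quot S) : {morph (@quot_scale S)^~ q : t u / t + u}.
Proof.
by move=> t u; rewrite -(dialg_reprK q) !quot_scaleE -dialg_piD scalerDl.
Qed.

HB.instance Definition _ S := GRing.Zmodule_isLmodule.Build k (dialg_quot S)
  (@quot_scaleA S) (@quot_scale1 S) (@quot_scaleDr S) (@quot_scaleDl S).

Fact dialg_piZ S t a : dialg_pi S (t *: a) = t *: dialg_pi S a.
Proof. by rewrite -quot_scaleE. Qed.

Fact quot_vdash_linearl S q : linear ((@quot_vdash S)^~ q).
Proof.
move=> t p p'; rewrite -(dialg_reprK p) -(dialg_reprK p') -(dialg_reprK q).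
by rewrite -dialg_piZ -dialg_piD !quot_vdashE vdash_linearl dialg_piD dialg_piZ.
Qed.

Fact quot_vdash_linearr S q : linear (@quot_vdash S q).
Proof.
move=> t p p'; rewrite -(dialg_reprK p) -(dialg_reprK p') -(dialg_reprK q).
by rewrite -dialg_piZ -dialg_piD !quot_vdashE vdash_linearr dialg_piD dialg_piZ.
Qed.

Fact quot_dashv_linearl S q : linear ((@quot_dashv S)^~ q).
Proof.
move=> t p p'; rewrite -(dialg_reprK p) -(dialg_reprK p') -(dialg_reprK q).
by rewrite -dialg_piZ -dialg_piD !quot_dashvE dashv_linearl dialg_piD dialg_piZ.
Qed.

Fact quot_dashv_linearr S q : linear (@quot_dashv S q).
Proof.
move=> t p p'; rewrite -(dialg_reprK p) -(dialg_reprK p') -(dialg_reprK q).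
by rewrite -dialg_piZ -dialg_piD !quot_dashvE dashv_linearr dialg_piD dialg_piZ.
Qed.

Fact quot_vdashA S : associative (@quot_vdash S).
Proof.
move=> p q r; rewrite -(dialg_reprK p) -(dialg_reprK q) -(dialg_reprK r).
by rewrite !quot_vdashE vdashA.
Qed.

Fact quot_dashvA S : associative (@quot_dashv S).
Proof.
move=> p q r; rewrite -(dialg_reprK p) -(dialg_reprK q) -(dialg_reprK r).
by rewrite !quot_dashvE dashvA.
Qed.

Fact quot_dashv_vdash S (p q r : dialg_quot S) :
  quot_dashv p (quot_vdash q r) = quot_dashv (quot_dashv p q) r.
Proof.
rewrite -(dialg_reprK p) -(dialg_reprK q) -(dialg_reprK r).
by rewrite !(quot_vdashE, quot_dashvE) dashv_vdash.
Qed.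

Fact quot_vdash_dashv S (p q r : dialg_quot S) :
  quot_vdash (quot_dashv p q) r = quot_vdash (quot_vdash p q) r.
Proof.
rewrite -(dialg_reprK p) -(dialg_reprK q) -(dialg_reprK r).
by rewrite !(quot_vdashE, quot_dashvE) vdash_dashv.
Qed.

Fact quot_vdash_dashvA S (p q r : dialg_quot S) :
  quot_vdash p (quot_dashv q r) = quot_dashv (quot_vdash p q) r.
Proof.
rewrite -(dialg_reprK p) -(dialg_reprK q) -(dialg_reprK r).
by rewrite !(quot_vdashE, quot_dashvE) vdash_dashvA.
Qed.

HB.instance Definition _ S := Lmodule_isDialgebra.Build k (dialg_quot S)
  (@quot_vdash_linearl S) (@quot_vdash_linearr S)
  (@quot_dashv_linearl S) (@quot_dashv_linearr S)
  (@quot_vdashA S) (@quot_dashvA S) (@quot_dashv_vdash S)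
  (@quot_vdash_dashv S) (@quot_vdash_dashvA S).

End Quotient.

(* The normal diword with center [dcenter], preceded by the letters [dleft]
   and followed by the letters [dright], both read from left to right. *)
Record diword (X : Type) := Diword {
  dleft : seq X;
  dcenter : X;
  dright : seq X
}.

Section Diwords.
Variable X : Type.
Implicit Types u v : diword X.

Definition word u : seq X := dleft u ++ dcenter u :: dright u.
Definition dsize u : nat := size (word u).
Definition letter (x : X) : diword X := Diword [::] x [::].

Definition diword_vdash u v : diword X :=
  Diword (word u ++ dleft v) (dcenter v) (dright v).
Definition diword_dashv u v : diword X :=
  Diword (dleft u) (dcenter u) (dright u ++ word v).

Definition tuple_of_diword u := (dleft u, dcenter u, dright u).
Definition diword_of_tuple (t : seq X * X * seq X) := Diword t.1.1 t.1.2 t.2.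
Fact tuple_of_diwordK : cancel tuple_of_diword diword_of_tuple.
Proof. by case. Qed.

End Diwords.

HB.instance Definition _ (X : choiceType) :=
  Choice.copy (diword X) (can_type (@tuple_of_diwordK X)).

(* D(X), the linear span of the normal diwords over X. *)
Definition free_dialg (k : fieldType) (X : choiceType) : Type :=
  {malg k[diword X]}.

Section FreeDialgebra.
Context (k : fieldType) (X : choiceType).
Local Notation D := (free_dialg k X).
Local Notation malg := {malg k[diword X]}.
Implicit Types f g h : malg.

HB.instance Definition _ := GRing.Lmodule.copy D malg.

(* The bilinear extension of a product of diwords. *)
Definition bilin (op : diword X -> diword X -> diword X) f g : malg :=
  \sum_(u <- msupp f) \sum_(v <- msupp g) << f@_u * g@_v *g op u v >>.

Section Bilin.
Variable op : diword X -> diword X -> diword X.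

Fact bilinw (d1 d2 : {fset diword X}) f g :
  fsubset (msupp f) d1 -> fsubset (msupp g) d2 ->
  bilin op f g = \sum_(u <- d1) \sum_(v <- d2) << f@_u * g@_v *g op u v >>.
Proof.
move=> le1 le2; rewrite /bilin (big_fset_incl _ le1) /=.
  apply/eq_bigr=> u _; apply/big_fset_incl => // v _ /mcoeff_outdom ->.
  by rewrite mulr0 monalgU0.
move=> u _ /mcoeff_outdom fu.
by rewrite big1 // => v _; rewrite fu mul0r monalgU0.
Qed.

Fact scaleU (t c : k) u : t *: << c *g u >> = << t * c *g u >> :> malg.
Proof.
apply/malgP=> v; rewrite mcoeffZ [X in _ * X]mcoeffU [RHS]mcoeffU.
exact: mulrnAr.
Qed.

Fact bilin_linearl g : linear ((bilin op)^~ g).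
Proof.
move=> t f f' /=.
have s1 : fsubset (msupp (t *: f + f')) (fsetU (msupp f) (msupp f')).
  apply: fsubset_trans (msuppD_le _ _) _.
  by apply: fsetSU; apply: msuppZ_le.
rewrite (bilinw s1 (fsubset_refl _)).
rewrite (bilinw (fsubsetUl _ (msupp f')) (fsubset_refl _)).
rewrite (bilinw (fsubsetUr (msupp f) _) (fsubset_refl _)).
rewrite scaler_sumr -big_split /=; apply: eq_bigr=> u _.
rewrite scaler_sumr -big_split /=; apply: eq_bigr=> v _.
by rewrite mcoeffD mcoeffZ scaleU mulrDl monalgUD mulrA.
Qed.

Fact bilin_linearr f : linear (bilin op f).
Proof.
move=> t g g' /=.
have s1 : fsubset (msupp (t *: g + g')) (fsetU (msupp g) (msupp g')).
  apply: fsubset_trans (msuppD_le _ _) _.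
  by apply: fsetSU; apply: msuppZ_le.
rewrite (bilinw (fsubset_refl _) s1).
rewrite (bilinw (fsubset_refl _) (fsubsetUl _ (msupp g'))).
rewrite (bilinw (fsubset_refl _) (fsubsetUr (msupp g) _)).
rewrite scaler_sumr -big_split /=; apply: eq_bigr=> u _.
rewrite scaler_sumr -big_split /=; apply: eq_bigr=> v _.
by rewrite mcoeffD mcoeffZ scaleU mulrDr monalgUD mulrCA.
Qed.

Fact bilinUU (a b : k) u v :
  bilin op << a *g u >> << b *g v >> = << a * b *g op u v >>.
Proof. by rewrite (bilinw msuppU_le msuppU_le) !big_seq_fset1 !mcoeffUU. Qed.

Fact bilin_suml (J : Type) (r : seq J) (F : J -> malg) g :
  bilin op (\sum_(j <- r) F j) g = \sum_(j <- r) bilin op (F j) g.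
Proof.
have add f f' : bilin op (f + f') g = bilin op f g + bilin op f' g.
  by have := bilin_linearl g 1 f f'; rewrite !scale1r.
apply: (big_morph (fun f => bilin op f g) add).
by apply: (addrI (bilin op 0 g)); rewrite -add !addr0.
Qed.

Fact bilin_sumr (J : Type) (r : seq J) (F : J -> malg) f :
  bilin op f (\sum_(j <- r) F j) = \sum_(j <- r) bilin op f (F j).
Proof.
have add g g' : bilin op f (g + g') = bilin op f g + bilin op f g'.
  by have := bilin_linearr f 1 g g'; rewrite !scale1r.
apply: (big_morph (bilin op f) add).
by apply: (addrI (bilin op f 0)); rewrite -add !addr0.
Qed.

End Bilin.

Fact bilinA (op1 op2 op3 op4 : diword X -> diword X -> diword X) :
  (forall u v w, op1 u (op2 v w) = op3 (op4 u v) w) ->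
  forall f g h, bilin op1 f (bilin op2 g h) = bilin op3 (bilin op4 f g) h.
Proof.
move=> opA f g h; rewrite [f]monalgE [g]monalgE [h]monalgE.
rewrite [LHS]bilin_suml.
rewrite [X in bilin op3 X _ ]bilin_suml [RHS]bilin_suml.
apply: eq_bigr=> u _.
rewrite [X in bilin op1 _ X]bilin_suml [LHS]bilin_sumr.
rewrite [X in bilin op3 X _ ]bilin_sumr [RHS]bilin_suml.
apply: eq_bigr=> v _.
rewrite [X in bilin op1 _ X]bilin_sumr [LHS]bilin_sumr [RHS]bilin_sumr.
apply: eq_bigr=> w _.
by rewrite !bilinUU opA mulrA.
Qed.

Local Notation dv := (@diword_vdash X).
Local Notation dd := (@diword_dashv X).

Fact free_vdashA f g h : bilin dv f (bilin dv g h) = bilin dv (bilin dv f g) h.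
Proof.
apply: bilinA => u v w.
by rewrite /diword_vdash /word /= -!catA /= -?catA.
Qed.

Fact free_dashvA f g h : bilin dd f (bilin dd g h) = bilin dd (bilin dd f g) h.
Proof.
apply: bilinA => u v w.
by rewrite /diword_dashv /word /= -!catA /= -?catA.
Qed.

Fact free_dashv_vdash f g h :
  bilin dd f (bilin dv g h) = bilin dd (bilin dd f g) h.
Proof.
apply: bilinA => u v w.
by rewrite /diword_dashv /diword_vdash /word /= -!catA /= -?catA.
Qed.

Fact free_vdash_dashv f g h :
  bilin dv (bilin dd f g) h = bilin dv (bilin dv f g) h.
Proof.
rewrite -free_vdashA; apply/esym; apply: bilinA => u v w.
by rewrite /diword_dashv /diword_vdash /word /= -!catA /= -?catA.
Qed.

Fact free_vdash_dashvA f g h :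
  bilin dv f (bilin dd g h) = bilin dd (bilin dv f g) h.
Proof. by apply: bilinA => u v w; rewrite /diword_dashv /diword_vdash. Qed.

HB.instance Definition _ := Lmodule_isDialgebra.Build k D
  (bilin_linearl dv) (bilin_linearr dv) (bilin_linearl dd) (bilin_linearr dd)
  free_vdashA free_dashvA free_dashv_vdash free_vdash_dashv free_vdash_dashvA.

Definition gen (x : X) : D := << letter x >>.

End FreeDialgebra.

(* [dichain vd dd [:: l_1; ...; l_m] c [:: r_1; ...; r_n]] is
   l_1 ⊢ ... ⊢ l_m ⊢ c ⊣ r_1 ⊣ ... ⊣ r_n for the products vd and dd; in a
   dialgebra its value does not depend on the bracketing. *)
Definition dichain {T : Type} (vd dd : T -> T -> T) (l : seq T) (c : T)
    (r : seq T) : T :=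
  foldr vd (foldl dd c r) l.

(* A chain of letters with one position left open: the center itself, a
   position to the left of the center [x], or one to its right. *)
Inductive dcontext (X : Type) :=
| AtCenter (a b : seq X)
| LeftOfCenter (a a' : seq X) (x : X) (b : seq X)
| RightOfCenter (a : seq X) (x : X) (b' b : seq X).

Section Contexts.
Context {X : Type}.

Definition fill {T : Type} (vd dd : T -> T -> T) (g : X -> T) (C : dcontext X)
    (t : T) : T :=
  match C with
  | AtCenter a b => dichain vd dd (map g a) t (map g b)
  | LeftOfCenter a a' x b =>
      dichain vd dd (map g a ++ t :: map g a') (g x) (map g b)
  | RightOfCenter a x b' b =>
      dichain vd dd (map g a) (g x) (map g b' ++ t :: map g b)
  end.

(* The words preceding and following the open position. *)
Definition prefix_word (C : dcontext X) : seq X :=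
  match C with
  | AtCenter a _ => a
  | LeftOfCenter a _ _ _ => a
  | RightOfCenter a x b' _ => a ++ x :: b'
  end.

Definition suffix_word (C : dcontext X) : seq X :=
  match C with
  | AtCenter _ b => b
  | LeftOfCenter _ a' x b => a' ++ x :: b
  | RightOfCenter _ _ _ b => b
  end.

Definition fill_diword (C : dcontext X) (w : diword X) : diword X :=
  fill (@diword_vdash X) (@diword_dashv X) (@letter X) C w.

End Contexts.

Section GroebnerShirshov.
Context {k : fieldType} {d : Order.disp_t} {X : orderType d}.
Local Notation D := (free_dialg k X).
Implicit Types (f g h s : D) (u v w : diword X) (C : dcontext X) (S : set D).

Definition wt w : nat *l (nat *l seqlexi X) :=
  (dsize w, (size (dleft w), word w)).

Definition deglex_lt v w : bool := (wt v < wt w)%O.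
Definition deglex_le v w : bool := (wt v <= wt w)%O.

(* [w] is the leading term of [f]; no [w] satisfies this when f = 0. *)
Definition leading f w : Prop :=
  w \in msupp f /\ forall v, v \in msupp f -> deglex_le v w.

Definition dmonic f : Prop := exists2 w, leading f w & f@_w = 1.

Definition left_normed f : Prop := forall w, w \in msupp f -> dright w = [::].
Definition right_normed f : Prop := forall w, w \in msupp f -> dleft w = [::].

(* The s-diword [asb]. *)
Definition sdiword C s : D := fill vdash dashv (@gen k X) C s.

Definition normal C s : Prop :=
  match C with
  | AtCenter _ _ => True
  | LeftOfCenter _ _ _ _ => left_normed s
  | RightOfCenter _ _ _ _ => right_normed s
  end.

Definition left_normed_sdiword C s : Prop :=
  [/\ normal C s, left_normed s & left_normed (sdiword C s)].
Definition right_normed_sdiword C s : Prop :=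
  [/\ normal C s, right_normed s & right_normed (sdiword C s)].

Definition sum_of_sdiwords S (P : dcontext X -> D -> Prop) h : Prop :=
  exists (n : nat) (t : 'I_n -> k) (C : 'I_n -> dcontext X) (s : 'I_n -> D),
    (forall i, S (s i) /\ P (C i) (s i)) /\
    h = \sum_i t i *: sdiword (C i) (s i).

(* For h = 0 no term qualifies, and only the empty sum is left. *)
Definition leading_size_le C s h : Prop :=
  exists u v, [/\ leading s u, leading h v
                & (dsize (fill_diword C u) <= dsize v)%N].

Definition leading_lt C s w : Prop :=
  exists2 u, leading s u & deglex_lt (fill_diword C u) w.

Definition trivial_left_mult S h : Prop :=
  sum_of_sdiwords S
    (fun C s => right_normed_sdiword C s /\ leading_size_le C s h) h.

Definition trivial_right_mult S h : Prop :=
  sum_of_sdiwords S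
    (fun C s => left_normed_sdiword C s /\ leading_size_le C s h) h.

(* [R] (resp. [L]) tells whether the terms of the decomposition are required
   to be right (resp. left) normed. *)
Definition trivial_mod S w (R L : Prop) h : Prop :=
  sum_of_sdiwords S
    (fun C s => [/\ normal C s, leading_lt C s w,
                    R -> right_normed_sdiword C s
                  & L -> left_normed_sdiword C s]) h.

Definition left_mult_trivial S : Prop :=
  forall f x, S f -> ~ right_normed f -> trivial_left_mult S (gen k x ⊣ f).

Definition right_mult_trivial S : Prop :=
  forall f x, S f -> ~ left_normed f -> trivial_right_mult S (f ⊢ gen k x).

Definition inclusion_trivial S : Prop :=
  forall f g w v C, S f -> S g -> leading f w -> leading g v ->
    w = fill_diword C v -> normal C g ->
    trivial_mod S w
      (right_normed f /\ right_normed_sdiword C g)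
      (left_normed f /\ left_normed_sdiword C g)
      (f - sdiword C g).

Definition intersection_trivial S : Prop :=
  forall f g w u v B A, S f -> S g -> leading f u -> leading g v ->
    prefix_word B = [::] -> suffix_word A = [::] ->
    w = fill_diword B u -> w = fill_diword A v ->
    (dsize w < dsize u + dsize v)%N -> normal B f -> normal A g ->
    trivial_mod S w
      (right_normed_sdiword B f /\ right_normed_sdiword A g)
      (left_normed_sdiword B f /\ left_normed_sdiword A g)
      (sdiword B f - sdiword A g).

Definition groebner_shirshov_basis S : Prop :=
  [/\ forall f, S f -> dmonic f,
      left_mult_trivial S /\ right_mult_trivial S,
      inclusion_trivial S & intersection_trivial S].

End GroebnerShirshov.

(* The subspace L_0. *)
Definition leibniz_kernel {k : fieldType} (L : leibnizType k) : set L :=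
  lin_span [set v : L | (exists a : L, v = bracket a a) \/
                        (exists a b : L, v = bracket a b + bracket b a)] id.

Arguments leibniz_kernel {k} L _ : assert.

Section Enveloping.
Context {k : fieldType} {L : leibnizType k} {d : Order.disp_t} {I : orderType d}.
Variables (x : I -> L) (I0 : set I).
Local Notation D := (free_dialg k I).
Local Notation "''x_' i" := (gen k i) (at level 8, i at level 2).

(* The element of D(X) obtained by writing a vector of L as a linear
   combination of the basis [x]. *)
Definition lin_poly (a : L) : D := lincomb (@gen k I) (coords x a).
Local Notation "{{ i , j }}" := (lin_poly (bracket (x i) (x j))).

Definition enveloping_relations : set D :=
  [set f | exists i j, f = 'x_i ⊣ 'x_j - 'x_j ⊢ 'x_i - {{i, j}}].

Definition enveloping : dialgType k := dialg_quot enveloping_relations.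

Definition enveloping_pi (f : D) : enveloping := dialg_pi _ f.

Definition enveloping_map (a : L) : commutator_leibniz enveloping :=
  enveloping_pi (lin_poly a).

Variant enveloping_gsb : D -> Prop :=
| GSB_a i j : enveloping_gsb ('x_j ⊢ 'x_i - 'x_i ⊣ 'x_j + {{i, j}})
| GSB_b i j t of (i < j)%O :
    enveloping_gsb ('x_j ⊢ 'x_i ⊢ 'x_t - 'x_i ⊢ 'x_j ⊢ 'x_t + {{i, j}} ⊢ 'x_t)
| GSB_c i0 t of I0 i0 : enveloping_gsb ('x_i0 ⊢ 'x_t)
| GSB_d i j t of (i < j)%O :
    enveloping_gsb ('x_t ⊣ 'x_j ⊣ 'x_i - 'x_t ⊣ 'x_i ⊣ 'x_j + 'x_t ⊣ {{i, j}})
| GSB_e i0 t of I0 i0 : enveloping_gsb ('x_t ⊣ 'x_i0).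

(* The index (j, [:: i_1; ...; i_r]) stands for x_j ⊣ x_{i_1} ⊣ ... ⊣ x_{i_r}. *)
Definition pbw_index : set (I * seq I) :=
  [set p | sorted <=%O p.2 /\ forall i, i \in p.2 -> ~ I0 i].

Definition pbw_monomial (p : I * seq I) : enveloping :=
  dichain vdash dashv [::] (enveloping_pi 'x_(p.1))
    [seq enveloping_pi 'x_i | i <- p.2].

End Enveloping.

(* Main.v *)
(* Let A be the free associative algebra on X modulo the Lie relations
   x_j x_i - x_i x_j + {x_i, x_j} and the letters of I_0, that is, the enveloping
   algebra of the Lie algebra L / L_0. Its rewriting rules terminate, since they
   shorten a word or remove an inversion, and they are confluent by the Leibniz
   identity; this is the Poincare-Birkhoff-Witt theorem for A. The tensor product
   of L with A, with right multiplication and the left action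
   x_j (a (x) r) = a (x) x_j r - {a, x_j} (x) r, is a model of U(L). It turns the
   reduction of a diword (all letters are moved to the right of the center, then
   sorted) into a linear map which vanishes on the ideal, and this gives the basis.

   The compositions are then trivial without any inspection of overlaps: a
   composition h lies in the ideal and involves only diwords below [w], so
   h is the sum of h_v (v - normal_form v), and each v - normal_form v is a
   combination of normal S-diwords with leading terms at most v. For left normed
   compositions the same argument is applied to the reduction which sorts the
   letters to the left of the center. *)
Require Import Defs.
From HB Require Import structures.
From mathcomp Require Import all_boot all_order all_algebra finmap.
From mathcomp.multinomials Require Import monalg.
From mathcomp Require Import boolp classical_sets wochoice.
From mathcomp Require Import zify.

Import Order.TTheory GRing.Theory.
Local Open Scope ring_scope.
Local Open Scope classical_set_scope.

Set Implicit Arguments.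
Unset Strict Implicit.
Unset Printing Implicit Defensive.

(** Neither A nor its tensor product with L is constructed. Both are replaced by the maps out of
    them: functions on words, or linear maps from L to functions on words, that satisfy the
    relations. The operations of U(L) then act by transposition, and the normal form is one such map
    with values in D(X). Confluence of the Lie rules is likewise tested against maps that satisfy
    the relations on smaller words, so that resolving an ambiguity is a computation with equations
    in a vector space. Maps on the tensor product alone do not cut out an ideal: in f ⊢ g and g ⊣ f
    the factor f loses its center and acts through its words, so f must also be killed by the
    functions on words that factor through A. The reduction used for left normed compositions is of
    another kind: it sends every diword that is not left normed to 0 and need not vanish on the
    ideal, because (a) mixes both kinds of diwords. It suffices that only (b) and (c) in S are left
    normed, and that f ⊢ x depends on f only through its words. *)

Section LinearProp.
Context {k : fieldType} {U V : lmodType k}.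
Implicit Type f : U -> V.

Lemma linearPD f : linear f -> forall a b, f (a + b) = f a + f b.
Proof. by move=> fl a b; have := fl 1 a b; rewrite !scale1r. Qed.

Lemma linearP0 f : linear f -> f 0 = 0.
Proof. by move=> fl; apply: (addrI (f 0)); rewrite -linearPD // !addr0. Qed.

Lemma linearPZ f : linear f -> forall t a, f (t *: a) = t *: f a.
Proof. by move=> fl t a; have := fl t a 0; rewrite linearP0 // !addr0. Qed.

Lemma linearPN f : linear f -> forall a, f (- a) = - f a.
Proof. by move=> fl a; rewrite -scaleN1r linearPZ // scaleN1r. Qed.

Lemma linearPB f : linear f -> forall a b, f (a - b) = f a - f b.
Proof. by move=> fl a b; rewrite linearPD // linearPN. Qed.

Lemma linearP_sum f : linear f -> forall (J : Type) (r : seq J) (F : J -> U),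
  f (\sum_(j <- r) F j) = \sum_(j <- r) f (F j).
Proof. by move=> fl J r F; apply: (big_morph f (linearPD fl) (linearP0 fl)). Qed.

Lemma linearP_lincomb f (J : choiceType) (e : J -> U) (c : {malg k[J]}) :
  linear f -> f (lincomb e c) = lincomb (f \o e) c.
Proof.
by move=> fl; rewrite /lincomb linearP_sum //; apply: eq_bigr => j _; rewrite linearPZ.
Qed.

End LinearProp.

Lemma linear_comp (k : fieldType) (U V W : lmodType k) (f : V -> W) (g : U -> V) :
  linear f -> linear g -> linear (fun a => f (g a)).
Proof. by move=> fl gl t a b; rewrite gl fl. Qed.

Lemma linear_sub (k : fieldType) (U V : lmodType k) (f g : U -> V) :
  linear f -> linear g -> linear (fun a => f a - g a).
Proof. by move=> fl gl t a b; rewrite gl fl opprD addrACA scalerBr. Qed.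

Lemma linear_add (k : fieldType) (U V : lmodType k) (f g : U -> V) :
  linear f -> linear g -> linear (fun a => f a + g a).
Proof. by move=> fl gl t a b; rewrite gl fl addrACA scalerDr. Qed.

(** * Linear combinations, subspaces and coordinates *)

Section Lincomb.
Context {k : fieldType} {V : lmodType k} {J : choiceType}.
Implicit Types (e : J -> V) (c : {malg k[J]}).

Lemma lincombEw e c (d : {fset J}) : fsubset (msupp c) d ->
  lincomb e c = \sum_(j <- d) c@_j *: e j.
Proof.
move=> le; rewrite /lincomb; apply: big_fset_incl => // j _ /mcoeff_outdom ->.
by rewrite scale0r.
Qed.

Fact lincomb_linear e : linear (lincomb e).
Proof.
move=> t c c'.
have s1 : fsubset (msupp (t *: c + c')) (fsetU (msupp c) (msupp c')).
  by apply: fsubset_trans (msuppD_le _ _) _; apply: fsetSU; apply: msuppZ_le.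
rewrite (lincombEw e s1).
rewrite (lincombEw e (fsubsetUl (msupp c) (msupp c'))).
rewrite (lincombEw e (fsubsetUr (msupp c) (msupp c'))).
rewrite scaler_sumr -big_split /=; apply: eq_bigr => j _.
by rewrite mcoeffD mcoeffZ scalerDl scalerA.
Qed.

HB.instance Definition _ e :=
  GRing.isLinear.Build k {malg k[J]} V *:%R (lincomb e) (lincomb_linear e).

Lemma lincombBr e c c' : lincomb e (c - c') = lincomb e c - lincomb e c'.
Proof. exact: raddfB. Qed.

Lemma lincomb0r e : lincomb e 0 = 0.
Proof. exact: raddf0. Qed.

Lemma lincombU e t j : lincomb e << t *g j >> = t *: e j.
Proof. by rewrite (lincombEw e msuppU_le) big_seq_fset1 mcoeffUU. Qed.

Lemma lincombU1 e j : lincomb e << j >> = e j.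
Proof. by rewrite lincombU scale1r. Qed.

Lemma eq_lincomb e e' c : (forall j, j \in msupp c -> e j = e' j) ->
  lincomb e c = lincomb e' c.
Proof. by move=> ee'; apply: eq_big_seq => j /ee' ->. Qed.

Lemma lincomb0 c : lincomb (fun=> 0 : V) c = 0.
Proof. by rewrite /lincomb big1 // => j _; rewrite scaler0. Qed.

Lemma lincombBl e e' c :
  lincomb (fun j => e j - e' j) c = lincomb e c - lincomb e' c.
Proof.
by rewrite /lincomb -sumrB; apply: eq_bigr => j _; rewrite scalerBr.
Qed.

Lemma lincomb_lin (W : lmodType k) (f : V -> W) e c : linear f ->
  lincomb (fun j => f (e j)) c = f (lincomb e c).
Proof. by move=> fl; rewrite linearP_lincomb. Qed.

(** Subspaces as bare predicates: support conditions, kernels, ideals and sums of S-diwords then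
    share one induction along [lincomb]. *)
Definition lin_closed (P : V -> Prop) : Prop :=
  P 0 /\ forall (t : k) a b, P a -> P b -> P (t *: a + b).

Lemma lin_closed_lincomb P e c : lin_closed P ->
  (forall j, j \in msupp c -> P (e j)) -> P (lincomb e c).
Proof.
move=> [P0 PZD] Pe; rewrite /lincomb big_seq_cond.
elim/big_rec: _ => // j a /andP[/Pe Pj _]; exact: PZD.
Qed.

Lemma lin_closed_ker (W : lmodType k) (f : V -> W) :
  linear f -> lin_closed (fun a => f a = 0).
Proof.
move=> fl; split=> [|t a b a0 b0]; first exact: linearP0.
by rewrite fl a0 b0 scaler0 addr0.
Qed.

Lemma lin_closedD P a b : lin_closed P -> P a -> P b -> P (a + b).
Proof. by move=> [_ PZD] Pa Pb; rewrite -[a]scale1r; apply: PZD. Qed.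

Lemma lin_closedN P a : lin_closed P -> P a -> P (- a).
Proof.
by move=> [P0 PZD] Pa; rewrite -[- a]addr0 -scaleN1r; apply: PZD.
Qed.

Lemma lin_closedB P a b : lin_closed P -> P a -> P b -> P (a - b).
Proof. by move=> Pl Pa Pb; apply: lin_closedD => //; apply: lin_closedN. Qed.

End Lincomb.

Lemma lincomb_exchange (k : fieldType) (V : lmodType k) (J J' : choiceType)
    (G : J -> J' -> V) (c : {malg k[J]}) (c' : {malg k[J']}) :
  lincomb (fun j => lincomb (G j) c') c = lincomb (fun j' => lincomb (G^~ j') c) c'.
Proof.
rewrite /lincomb (eq_bigr _ (fun j _ => scaler_sumr _ _ _ _)).
rewrite [RHS](eq_bigr _ (fun j' _ => scaler_sumr _ _ _ _)) exchange_big /=.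
by apply: eq_bigr => j' _; apply: eq_bigr => j _; rewrite !scalerA mulrC.
Qed.

Section MalgBasis.
Context {k : fieldType} {J : choiceType}.
Implicit Type c : {malg k[J]}.

Lemma malg_scaleU (t a : k) (j : J) : t *: << a *g j >> = << t * a *g j >>.
Proof. by apply/malgP=> l; rewrite mcoeffZ !mcoeffU mulrnAr. Qed.

Lemma lincomb_id c : lincomb (fun j => << j >>) c = c.
Proof.
rewrite {2}[c]monalgE; apply: eq_bigr => j _.
by rewrite malg_scaleU mulr1.
Qed.

Lemma linear_malgE (V : lmodType k) (f : {malg k[J]} -> V) c :
  linear f -> f c = lincomb (fun j => f << j >>) c.
Proof. by move=> fl; rewrite lincomb_lin // lincomb_id. Qed.

Lemma msupp_closed (A : J -> Prop) :
  lin_closed (fun c : {malg k[J]} => forall j, j \in msupp c -> A j).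
Proof.
split=> [j|t a b Aa Ab j]; first by rewrite msupp0.
move/(fsubsetP (msuppD_le _ _)); rewrite in_fsetU => /orP[|/Ab //].
by move/(fsubsetP (msuppZ_le _ _))/Aa.
Qed.

Lemma msuppU1_eq (j l : J) : (l \in msupp (<< j >> : {malg k[J]})) = (l == j).
Proof. by rewrite msuppU oner_eq0 in_fset1. Qed.

End MalgBasis.

Section Coordinates.
Context {k : fieldType} {L : lmodType k} {I : choiceType} {x : I -> L}.
Context (x_basis : is_basis [set: I] x [set: L]).

Lemma coordsK a : lincomb x (coords x a) = a.
Proof.
have : [set: L] a by [].
by rewrite -x_basis.2 => -[c _ ca]; rewrite /coords; case: xgetP => // /(_ c).
Qed.

Lemma lincomb_basis_inj (c c' : {malg k[I]}) : lincomb x c = lincomb x c' -> c = c'.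
Proof.
move=> cc'; apply/eqP; rewrite -subr_eq0; apply/eqP/x_basis.1 => //.
by rewrite raddfB /= cc' subrr.
Qed.

Lemma coords_linear : linear (coords x).
Proof.
by move=> t a b; apply: lincomb_basis_inj; rewrite linearP /= !coordsK.
Qed.

Lemma coords_basis i : coords x (x i) = << i >>.
Proof. by apply: lincomb_basis_inj; rewrite coordsK lincombU1. Qed.

Lemma linear_basis_ext (V : lmodType k) (f g : L -> V) : linear f -> linear g ->
  (forall i, f (x i) = g (x i)) -> forall a, f a = g a.
Proof.
move=> fl gl fg a; rewrite -(coordsK a) -!lincomb_lin //.
by apply: eq_lincomb => i _; apply: fg.
Qed.

Lemma coords_lincomb_linear (V : lmodType k) (e : I -> V) :
  linear (fun a => lincomb e (coords x a)).
Proof. by move=> t a b; rewrite coords_linear linearP. Qed.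

Lemma coords_sub (A : set I) (W : set L) a : is_basis A x W -> W a ->
  forall i, i \in msupp (coords x a) -> A i.
Proof.
move=> [_ <-] [c Ac ca].
suff -> : coords x a = c by [].
by apply: lincomb_basis_inj; rewrite coordsK.
Qed.

End Coordinates.

(** * Normal forms for a confluent linear rewriting system *)
Section Rewriting.
Context {k : fieldType} {W : choiceType}.
Local Notation A := {malg k[W]}.
(* [red w h]: [w] rewrites to the combination [h]. *)
Variables (red : W -> A -> Prop) (mu : W -> nat).
Hypothesis red_mu : forall w h, red w h -> forall v, v \in msupp h -> (mu v < mu w)%N.

Definition respects (V : lmodType k) (F : W -> V) (n : nat) : Prop :=
  forall v h, red v h -> (mu v < n)%N -> F v = lincomb F h.

(** The condition of Bergman's diamond lemma: the two sides of an ambiguity agree modulo the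
    relations at smaller words. Testing with all maps [F] expresses this without naming the subspace
    spanned by those relations. *)
Hypothesis confluent : forall w h h', red w h -> red w h' ->
  forall (V : lmodType k) (F : W -> V), respects F (mu w) -> lincomb F h = lincomb F h'.

Definition irreducible w := ~ exists h, red w h.

(** The step taken is an arbitrary choice made by [cid]. Every step lowers [mu], so [mu w] plus one
    units of fuel always reach irreducible words. *)
Fixpoint nf_fuel (n : nat) (w : W) : A :=
  if n is n'.+1 then
    if pselect (exists h, red w h) is left ex then
      lincomb (nf_fuel n') (projT1 (cid ex))
    else << w >>
  else << w >>.

Definition nf (w : W) : A := nf_fuel (mu w).+1 w.

Lemma nf_fuelE n w : (mu w < n)%N -> nf_fuel n w = nf w.
Proof.
rewrite /nf; elim/ltn_ind: n w => -[//|n] IH w; rewrite ltnS => le_wn /=.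
case: pselect => // ex; case: cid => h /= /red_mu rh.
apply: eq_lincomb => v /rh lt_vw.
by rewrite IH ?(leq_trans lt_vw) // [RHS]IH.
Qed.

Lemma nf_irreducible w : irreducible w -> nf w = << w >>.
Proof. by rewrite /nf /=; case: pselect. Qed.

Lemma nf_step w : (exists h, red w h) -> exists2 h, red w h & nf w = lincomb nf h.
Proof.
rewrite /nf /=; case: pselect => // ex _; case: cid => h /= rh; exists h => //.
by apply: eq_lincomb => v /(red_mu rh) lt_vw; rewrite nf_fuelE.
Qed.

Lemma nf_red w h : red w h -> nf w = lincomb nf h.
Proof.
have [n] := ubnP (mu w); elim: n w h => // n IH w h; rewrite ltnS => le_wn rh.
have [h' rh' ->] := nf_step (ex_intro _ h rh).
(* Confluence is tested with [F := nf] itself: the induction hypothesis says that [nf] respects the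
   rules below [w]. *)
apply: (confluent rh' rh) => v g rv lt_vw; apply: IH => //.
exact: leq_trans lt_vw le_wn.
Qed.

Lemma nf_supp w v : v \in msupp (nf w) -> irreducible v.
Proof.
have [n] := ubnP (mu w); elim: n w v => // n IH w v; rewrite ltnS => le_wn.
have [/nf_step[h rh ->]|irr] := pselect (exists h, red w h); last first.
  by rewrite nf_irreducible // msuppU1_eq => /eqP ->.
move: v; apply: (lin_closed_lincomb (msupp_closed _)) => u uh v; apply: IH.
exact: leq_trans (red_mu rh uh) le_wn.
Qed.

(** While [mu] serves termination, [le] records that all steps used start at words bounded by [w].
    With [F] an embedding into D(X), [P] the sums of S-diwords and [le] the deg-lex order, a
    reduction becomes a combination of S-diwords with controlled leading terms. *)
Lemma nf_reduction (le : rel W) (V : lmodType k) (F : W -> V) (P : V -> Prop) w :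
  reflexive le -> transitive le ->
  (forall v h, red v h -> forall u, u \in msupp h -> le u v) ->
  lin_closed P ->
  (forall v h, red v h -> le v w -> P (F v - lincomb F h)) ->
  P (F w - lincomb F (nf w)).
Proof.
move=> le_refl le_tr red_le Pl.
have [n] := ubnP (mu w); elim: n w => // n IH w; rewrite ltnS => le_wn PF.
have [/nf_step[h rh ->]|irr] := pselect (exists h, red w h); last first.
  by rewrite nf_irreducible // lincombU1 subrr; case: Pl.
rewrite -[F w](subrK (lincomb F h)) -addrA.
apply: (lin_closedD Pl); first exact: PF.
rewrite -(lincomb_lin nf h (lincomb_linear F)) -lincombBl.
apply: (lin_closed_lincomb Pl) => u uh; apply: IH.
  exact: leq_trans (red_mu rh uh) le_wn.
move=> v g rv le_vu; apply: PF => //; exact: le_tr le_vu (red_le _ _ rh _ uh).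
Qed.

End Rewriting.

(** * Inversions of words and the termination measure *)

Section Inversions.
Context {d : Order.disp_t} {I : orderType d}.
Implicit Types (s u v : seq I) (i j : I).

Fixpoint inversions s : nat :=
  if s is i :: s' then (count (fun j => (j < i)%O) s' + inversions s')%N else 0%N.

Lemma inversions_swap u v i j : (i < j)%O ->
  inversions (u ++ j :: i :: v) = (inversions (u ++ i :: j :: v)).+1.
Proof.
move=> ij; elim: u => [|m u IH] /=.
  by rewrite ij [(j < i)%O]lt_gtF // /=; lia.
rewrite IH addnS; congr (_ + _).+1; apply/permP.
by rewrite perm_cat2l -[j :: i :: v]/([:: j; i] ++ v) -[i :: j :: v]/([:: i; j] ++ v)
  perm_cat2r; apply/permP => p /=; lia.
Qed.

(** A crude bound, but n^3 + n^2 < (n + 1)^3 is all that the measure requires. *)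
Lemma inversions_le s : (inversions s <= size s * size s)%N.
Proof.
elim: s => //= i s IH; have := count_size (fun j => (j < i)%O) s.
move=> le_count; rewrite mulSn mulnS leq_add //; first exact: leqW.
exact: leq_trans IH (leq_addl _ _).
Qed.

(* The cube makes a longer word larger than any shorter one, whatever their
   inversions. *)
Definition word_measure s : nat := (size s * size s * size s + inversions s)%N.

Lemma word_measure_size s u : (size s < size u)%N -> (word_measure s < word_measure u)%N.
Proof.
rewrite /word_measure => lt_su.
apply: leq_trans (leq_trans (leq_mul (leq_mul lt_su lt_su) lt_su) (leq_addr _ _)).
by have := inversions_le s; set n := size s; set m := inversions s; nia.
Qed.

Lemma word_measure_swap u v i j : (i < j)%O ->
  (word_measure (u ++ i :: j :: v) < word_measure (u ++ j :: i :: v))%N.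
Proof.
by move=> ij; rewrite /word_measure (inversions_swap _ _ ij) !size_cat /=; lia.
Qed.

Lemma unsorted_descent s : ~~ sorted <=%O s ->
  exists u v i j, (i < j)%O /\ s = u ++ j :: i :: v.
Proof.
case: s => // i s; elim: s i => //= j s IH i.
have [ij /=|ji _] := leP i j; last by exists [::], s, j, i.
by move=> /IH [u [v [i' [j' [lt_ij ->]]]]]; exists (i :: u), v, i', j'.
Qed.

Lemma sorted_descent u v i j : (i < j)%O -> sorted <=%O (u ++ j :: i :: v) = false.
Proof.
move=> ij; apply/negP; elim: u => [|m u IH] /=; first by rewrite leNgt ij.
by move/path_sorted.
Qed.

End Inversions.

(** * The kernel of a Leibniz algebra *)
Section Kernel.
Context {k : fieldType} {L : leibnizType k}.
Implicit Types a b c : L.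

Lemma bracketDl a b c : bracket (a + b) c = bracket a c + bracket b c.
Proof. exact: (linearPD (bracket_linearl c)). Qed.

Lemma bracketDr a b c : bracket a (b + c) = bracket a b + bracket a c.
Proof. exact: (linearPD (bracket_linearr a)). Qed.

Lemma bracket0l c : bracket 0 c = 0 :> L.
Proof. exact: (linearP0 (bracket_linearl c)). Qed.

Lemma lin_span_gen (A : set L) a : A a -> lin_span A id a.
Proof.
move=> Aa; exists << a >>; last by rewrite lincombU1.
by move=> b; rewrite msuppU1_eq => /eqP ->.
Qed.

Lemma leibniz_kernel_sq a : leibniz_kernel L (bracket a a).
Proof. by apply: lin_span_gen; left; exists a. Qed.

Lemma leibniz_kernel_sym a b : leibniz_kernel L (bracket a b + bracket b a).
Proof. by apply: lin_span_gen; right; exists a, b. Qed.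

Lemma leibniz_kernel_closed : lin_closed (leibniz_kernel L).
Proof.
split=> [|t a b [ca Ca <-] [cb Cb <-]].
  by exists 0; [move=> j; rewrite msupp0 | rewrite raddf0].
by exists (t *: ca + cb); [apply: (msupp_closed _).2 | rewrite linearP].
Qed.

Lemma leibniz_kernel_ind (P : L -> Prop) : lin_closed P ->
  (forall a, P (bracket a a)) -> (forall a b, P (bracket a b + bracket b a)) ->
  forall v, leibniz_kernel L v -> P v.
Proof.
move=> Pl Psq Psym v [c Cc <-]; apply: (lin_closed_lincomb Pl) => a /Cc[].
  by move=> [b ->]; apply: Psq.
by move=> [b [b' ->]]; apply: Psym.
Qed.

(** The Leibniz identity for c, a, a reads {{c,a},a} = {{c,a},a} + {c,{a,a}}; for the symmetric
    generators it is used twice. *)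
Lemma bracket_kernelr c v : leibniz_kernel L v -> bracket c v = 0.
Proof.
move: v; apply: leibniz_kernel_ind => [|a|a b].
- exact: lin_closed_ker (bracket_linearr c).
- by apply: (addrI (bracket (bracket c a) a)); rewrite addr0 -leibniz_identity.
- apply: (addrI (bracket (bracket c b) a)); rewrite addr0 bracketDr addrA.
  by rewrite -leibniz_identity -leibniz_identity.
Qed.

(** Bracketing a generator with c gives {{a,c},a} + {a,{a,c}}, or a sum of two such symmetric
    expressions. With [bracket_kernelr], L_0 is a two-sided ideal. *)
Lemma bracket_kernell v c : leibniz_kernel L v -> leibniz_kernel L (bracket v c).
Proof.
have Kl := leibniz_kernel_closed.
move: v; apply: leibniz_kernel_ind => [|a|a b].
- split=> [|t a b Ka Kb]; first by rewrite bracket0l; case: Kl.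
  by rewrite bracket_linearl; apply: Kl.2.
- by rewrite leibniz_identity; apply: leibniz_kernel_sym.
- rewrite bracketDl (leibniz_identity a b) (leibniz_identity b a).
  rewrite [X in _ + X]addrC addrACA.
  by apply: (lin_closedD Kl); apply: leibniz_kernel_sym.
Qed.

End Kernel.

(** * Normal forms in the enveloping algebra of the Lie algebra L / L_0 *)
Section LieWords.
Context {k : fieldType} {L : leibnizType k} {d : Order.disp_t} {I : orderType d}.
Context {x : I -> L} {I0 : set I}.
Context (x_basis : is_basis [set: I] x [set: L]).
Context (x_basis0 : is_basis I0 x (leibniz_kernel L)).
Local Notation A := {malg k[seq I]}.
Local Notation "{{ i , j }}" := (bracket (x i) (x j)).
Implicit Types (u v w : seq I) (i j p m : I) (a b : L).

(* [F] evaluated at the word [u a v] in which the vector [a] stands for the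
   corresponding combination of letters. *)
Definition insert {V : lmodType k} (F : seq I -> V) u a v : V :=
  lincomb (fun m => F (u ++ m :: v)) (coords x a).

(** Brackets are expanded over the whole basis of L, so a swap may create letters of [I0]; [LieKill]
    removes them. *)
Inductive lie_red : seq I -> A -> Prop :=
| LieSwap u v i j of (i < j)%O : lie_red (u ++ j :: i :: v)
    (<< u ++ i :: j :: v >> - insert (fun w => << w >>) u {{i, j}} v)
| LieKill u v p of I0 p : lie_red (u ++ p :: v) 0.

Local Notation mu := (@word_measure d I).

Lemma lie_red_mu w h : lie_red w h -> forall v, v \in msupp h -> (mu v < mu w)%N.
Proof.
case=> [u v i j ij|u v p _]; last by move=> ?; rewrite msupp0.
have Pl := msupp_closed (k := k) (fun w' => (mu w' < mu (u ++ j :: i :: v))%N).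
apply: (lin_closedB Pl) => [w'|].
  by rewrite msuppU1_eq => /eqP ->; apply: word_measure_swap.
apply: (lin_closed_lincomb Pl) => m _ w'; rewrite msuppU1_eq => /eqP ->.
by apply: word_measure_size; rewrite !size_cat /= !addnS.
Qed.

Lemma kernelI0 p : I0 p -> leibniz_kernel L (x p).
Proof.
move=> I0p; rewrite -x_basis0.2; exists << p >>; last by rewrite lincombU1.
by move=> i; rewrite msuppU1_eq => /eqP ->.
Qed.

Lemma insert_linear (V : lmodType k) (F : seq I -> V) u v :
  linear (fun a => insert F u a v).
Proof. exact: coords_lincomb_linear. Qed.

Lemma insert_basis (V : lmodType k) (F : seq I -> V) u i v :
  insert F u (x i) v = F (u ++ i :: v).
Proof. by rewrite /insert (coords_basis x_basis) lincombU1. Qed.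

Lemma lincomb_insert (V : lmodType k) (F : seq I -> V) u a v :
  lincomb F (insert (fun w => << w >> : A) u a v) = insert F u a v.
Proof.
rewrite /insert linearP_lincomb; last exact: lincomb_linear.
by apply: eq_lincomb => m _ /=; rewrite lincombU1.
Qed.

Lemma lincomb_swap (V : lmodType k) (F : seq I -> V) w u a v :
  lincomb F (<< w >> - insert (fun w => << w >>) u a v) = F w - insert F u a v.
Proof. by rewrite lincombBr lincombU1 lincomb_insert. Qed.

Section Respects.
Context {V : lmodType k} (F : seq I -> V) (n : nat).
Hypothesis F_respects : respects lie_red mu F n.

Lemma respects_kill u p v : I0 p -> (mu (u ++ p :: v) < n)%N -> F (u ++ p :: v) = 0.
Proof. by move=> I0p lt_n; rewrite (F_respects (LieKill u v I0p)) // raddf0. Qed.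

Lemma respects_swap_lt u v i j : (i < j)%O -> (mu (u ++ j :: i :: v) < n)%N ->
  F (u ++ j :: i :: v) = F (u ++ i :: j :: v) - insert F u {{i, j}} v.
Proof.
move=> ij lt_n; by rewrite (F_respects (LieSwap u v ij)) // lincomb_swap.
Qed.

Lemma respects_kernel u a v : leibniz_kernel L a ->
  (forall m, mu (u ++ m :: v) < n)%N -> insert F u a v = 0.
Proof.
move=> Ka lt_n; rewrite -[RHS](lincomb0 (coords x a)); apply: eq_lincomb => m ma.
by apply: respects_kill => //; apply: (coords_sub x_basis x_basis0 Ka).
Qed.

(** The rule covers descents only. The relation for the opposite order and for equal letters follows
    because {i,j} + {j,i} and {i,i} lie in L_0, where [F] vanishes. *)
Lemma respects_swap u v i j : (mu (u ++ j :: i :: v) < n)%N ->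
  (mu (u ++ i :: j :: v) < n)%N ->
  F (u ++ j :: i :: v) = F (u ++ i :: j :: v) - insert F u {{i, j}} v.
Proof.
move=> lt1 lt2.
have lt_m m : (mu (u ++ m :: v) < n)%N.
  by apply: leq_trans lt1; rewrite ltnS ltnW // word_measure_size // !size_cat /= !addnS.
case: (ltgtP i j) => [ij|ji|->].
- exact: respects_swap_lt.
- rewrite (respects_swap_lt ji) // -addrA -opprD -(linearPD (insert_linear F u v)).
  by rewrite addrC (respects_kernel (leibniz_kernel_sym _ _)) ?oppr0 ?add0r // subr0.
- by rewrite (respects_kernel (leibniz_kernel_sq _)) // subr0.
Qed.

Context (N : nat) (le_N : forall s, (size s <= N)%N -> (mu s < n)%N).

Lemma insert_comm u a i v : (size u + size v + 2 <= N)%N ->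
  insert F u a (i :: v) = insert F (u ++ [:: i]) a v + insert F u (bracket a (x i)) v.
Proof.
move=> size_uv; move: a.
apply: (linear_basis_ext x_basis); first exact: insert_linear.
  apply: linear_add; first exact: insert_linear.
  by apply: linear_comp (insert_linear F u v) (bracket_linearl _).
move=> m; rewrite !insert_basis -catA /=.
by rewrite (@respects_swap u v m i) ?subrK //; apply: le_N; rewrite size_cat /=; lia.
Qed.

End Respects.

(** L_0 is an ideal, so a bracket that consumes a letter of [I0] is spanned by letters of [I0]. This
    settles every ambiguity involving [LieKill]: both sides evaluate to 0. *)
Lemma lie_red_support_kill w h : (exists2 p, I0 p & p \in w) -> lie_red w h ->
  forall v, v \in msupp h -> exists2 p, I0 p & p \in v.
Proof.
move=> wI0 rh; case: rh wI0 => [u v i j ij|u v p _] [q I0q]; last first.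
  by move=> _ w'; rewrite msupp0.
rewrite mem_cat !inE => q_in.
have Pl := msupp_closed (k := k) (fun w' : seq I => exists2 p, I0 p & p \in w').
apply: (lin_closedB Pl) => [w'|].
  rewrite msuppU1_eq => /eqP ->; exists q => //; rewrite mem_cat !inE.
  by case/or4P: q_in => ->; rewrite ?orbT.
apply: (lin_closed_lincomb Pl) => m m_in w'; rewrite msuppU1_eq => /eqP ->.
have [q_out|] := boolP ((q \in u) || (q \in v)).
  by exists q => //; rewrite mem_cat inE; case/orP: q_out => ->; rewrite ?orbT.
rewrite negb_or => /andP[/negbTE qu /negbTE qv].
exists m; last by rewrite mem_cat inE eqxx orbT.
apply: (coords_sub x_basis x_basis0) m_in.
move: q_in; rewrite qu qv orbF /= => /orP[/eqP <-|/eqP <-].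
  by rewrite bracket_kernelr; [case: (@leibniz_kernel_closed k L) | apply: kernelI0].
exact: bracket_kernell (kernelI0 I0q).
Qed.

(** Each side is reduced by the other swap. The same four kinds of terms appear; those with both
    brackets inserted agree by exchanging the two sums. *)
Lemma lie_confluent_disjoint (V : lmodType k) (F : seq I -> V) u e v i j i' j' :
  (i < j)%O -> (i' < j')%O ->
  respects lie_red mu F (mu (u ++ j :: i :: e ++ j' :: i' :: v)) ->
  F (u ++ i :: j :: e ++ j' :: i' :: v) - insert F u {{i, j}} (e ++ j' :: i' :: v) =
  F (u ++ j :: i :: e ++ i' :: j' :: v) - insert F (u ++ j :: i :: e) {{i', j'}} v.
Proof.
move=> ij ij'; set w := u ++ _ => resF.
have catE s s' p q : u ++ p :: q :: s ++ s' = (u ++ p :: q :: s) ++ s'.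
  by rewrite -catA.
have step1 : F (u ++ i :: j :: e ++ j' :: i' :: v) =
    F (u ++ i :: j :: e ++ i' :: j' :: v) - insert F (u ++ i :: j :: e) {{i', j'}} v.
  by rewrite !catE; apply: (respects_swap_lt resF) => //; rewrite -catE word_measure_swap.
have step2 : F (u ++ j :: i :: e ++ i' :: j' :: v) =
    F (u ++ i :: j :: e ++ i' :: j' :: v) - insert F u {{i, j}} (e ++ i' :: j' :: v).
  by apply: (respects_swap_lt resF) => //; rewrite /w !catE word_measure_swap.
have step3 : insert F u {{i, j}} (e ++ j' :: i' :: v) =
    insert F u {{i, j}} (e ++ i' :: j' :: v) -
    lincomb (fun m => insert F (u ++ m :: e) {{i', j'}} v) (coords x {{i, j}}).
  rewrite -lincombBl; apply: eq_lincomb => m _.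
  rewrite -!cat_cons !catA; apply: (respects_swap_lt resF) => //.
  by apply: word_measure_size; rewrite !size_cat /= !size_cat /=; lia.
have step4 : insert F (u ++ j :: i :: e) {{i', j'}} v =
    insert F (u ++ i :: j :: e) {{i', j'}} v -
    lincomb (fun m => insert F u {{i, j}} (e ++ m :: v)) (coords x {{i', j'}}).
  rewrite -lincombBl; apply: eq_lincomb => m _.
  rewrite -!catE; apply: (respects_swap_lt resF) => //.
  by apply: word_measure_size; rewrite !size_cat /= !size_cat /=; lia.
have step5 : lincomb (fun m => insert F (u ++ m :: e) {{i', j'}} v) (coords x {{i, j}}) =
    lincomb (fun m => insert F u {{i, j}} (e ++ m :: v)) (coords x {{i', j'}}).
  rewrite /insert lincomb_exchange; apply: eq_lincomb => m _; apply: eq_lincomb => m' _.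
  by rewrite -catA.
by rewrite step1 step2 step3 step4 step5 !opprB !addrA [LHS](ACl (1*4*3*2)).
Qed.

(** The overlap c b a of two swaps. Both sides are brought to the order a b c, then each bracket is
    moved past the third letter by [insert_comm]; what remains is a Jacobi identity. *)
Lemma lie_confluent_overlap (V : lmodType k) (F : seq I -> V) u v (a b c : I) :
  (a < b)%O -> (b < c)%O ->
  respects lie_red mu F (mu (u ++ c :: b :: a :: v)) ->
  F (u ++ b :: c :: a :: v) - insert F u {{b, c}} (a :: v) =
  F (u ++ c :: a :: b :: v) - insert F (u ++ [:: c]) {{a, b}} v.
Proof.
move=> ab bc; set w := u ++ _ => resF; have ac := lt_trans ab bc.
(* One less than the length of [w]: once a bracket has replaced two letters, the word has at most
   this length and is below [w]. *)
pose N := (size u + size v + 2)%N.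
have le_N s : (size s <= N)%N -> (mu s < mu w)%N.
  by move=> sN; apply: word_measure_size; rewrite size_cat /=; rewrite /N in sN; lia.
have catE p q r s : u ++ [:: p, q, r & s] = (u ++ [:: p]) ++ [:: q, r & s] by rewrite -catA.
have lt1 : (mu (u ++ b :: c :: a :: v) < mu w)%N by apply: word_measure_swap.
have lt2 : (mu (u ++ c :: a :: b :: v) < mu w)%N.
  by rewrite /w !(catE c); apply: word_measure_swap.
have lt3 : (mu (u ++ b :: a :: c :: v) < mu w)%N.
  by apply: ltn_trans lt1; rewrite !(catE b); apply: word_measure_swap.
have lt4 : (mu (u ++ a :: c :: b :: v) < mu w)%N.
  by apply: ltn_trans lt2; apply: word_measure_swap.
have -> : F (u ++ b :: c :: a :: v) =
    F (u ++ b :: a :: c :: v) - insert F (u ++ [:: b]) {{a, c}} v.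
  by rewrite !catE; apply: (respects_swap_lt resF ac); rewrite -catE.
rewrite (respects_swap_lt resF ac) //.
have -> : F (u ++ a :: c :: b :: v) =
    F (u ++ a :: b :: c :: v) - insert F (u ++ [:: a]) {{b, c}} v.
  by rewrite !catE; apply: (respects_swap_lt resF bc); rewrite -catE.
rewrite (respects_swap_lt resF ab) // !(insert_comm resF le_N) //.
(* By the Leibniz identity the two sides differ by the insertion of {a,{b,c}} + {{b,c},a}, a
   generator of L_0. *)
have -> : insert F u (bracket {{a, c}} (x b)) v =
    insert F u (bracket {{a, b}} (x c)) v + insert F u (bracket {{b, c}} (x a)) v.
  apply/eqP; rewrite -(linearPD (insert_linear F u v)) eq_sym -subr_eq0.
  rewrite -(linearPB (insert_linear F u v)) leibniz_identity -[X in X - _]addrA addrAC subrr add0r.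
  apply/eqP/(respects_kernel resF (leibniz_kernel_sym _ _)) => m.
  by apply: le_N; rewrite /N size_cat /=; lia.
rewrite -!addrA -!opprD; congr (_ - _); rewrite !addrA.
by rewrite [LHS](ACl (4*3*2*5*1)).
Qed.

Lemma lie_confluent_swap (V : lmodType k) (F : seq I -> V) u v i j u' v' i' j' :
  (i < j)%O -> (i' < j')%O ->
  u ++ j :: i :: v = u' ++ j' :: i' :: v' -> (size u <= size u')%N ->
  respects lie_red mu F (mu (u ++ j :: i :: v)) ->
  F (u ++ i :: j :: v) - insert F u {{i, j}} v =
  F (u' ++ i' :: j' :: v') - insert F u' {{i', j'}} v'.
Proof.
move=> ij ij' eq_w le_uu'.
have {le_uu'}[e eu'] : exists e, u' = u ++ e.
  exists (drop (size u) u'); rewrite -{1}(cat_take_drop (size u) u'); congr (_ ++ _).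
  have := congr1 (take (size u)) eq_w.
  rewrite take_size_cat // take_cat ltn_neqAle le_uu' andbT.
  by case: eqP => [->|_] //=; rewrite subnn take0 cats0 take_size.
move: eq_w; rewrite {}eu' -catA => /eqP; rewrite eqseq_cat // eqxx /= => /eqP.
(* The offset [e] between the two descents decides: empty for the same swap, one letter for an
   overlap, at least two letters for disjoint swaps. *)
case: e => [[<- <- <-]|q [[<- eq_i ->]|q' e [<- <- ->]]] resF //=.
- by rewrite cats0.
- by rewrite -eq_i in ij' *; rewrite -catA; apply: lie_confluent_overlap.
- by rewrite -catA; apply: lie_confluent_disjoint.
Qed.

Lemma lie_confluent w h h' : lie_red w h -> lie_red w h' ->
  forall (V : lmodType k) (F : seq I -> V),
    respects lie_red mu F (mu w) -> lincomb F h = lincomb F h'.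
Proof.
move=> rh rh' V F resF.
have [wI0|wI0] := pselect (exists2 p, I0 p & p \in w).
  suff zero g : lie_red w g -> lincomb F g = 0 by rewrite !zero.
  move=> rg; rewrite -[RHS](lincomb0 g); apply: eq_lincomb => v vg.
  have [p I0p pv] := lie_red_support_kill wI0 rg vg.
  have := lie_red_mu rg vg; case/path.splitPr: pv => v1 v2.
  exact: (respects_kill resF).
case: rh rh' wI0 resF => {w h} [u v i j ij|u v p I0p]; last first.
  by move=> _ []; exists p => //; rewrite mem_cat inE eqxx orbT.
have [w eq_w] : exists w, w = u ++ j :: i :: v by exists (u ++ j :: i :: v).
rewrite -eq_w => rh'; case: rh' eq_w => {w h'} [u' v' i' j' ij'|u' v' p I0p]; last first.
  by move=> _ []; exists p => //; rewrite mem_cat inE eqxx orbT.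
move=> eq_w _ resF.
apply: (etrans (lincomb_swap F (u ++ i :: j :: v) u _ v)).
apply/esym/(etrans (lincomb_swap F (u' ++ i' :: j' :: v') u' _ v'))/esym.
have [le_uu'|/ltnW le_u'u] := leqP (size u) (size u').
  by apply: lie_confluent_swap => //; rewrite -eq_w.
by apply/esym/lie_confluent_swap.
Qed.

Definition lie_nf : seq I -> A := nf lie_red mu.

Lemma lie_nf_respects n : respects lie_red mu lie_nf n.
Proof. by move=> w h rh _; apply: (nf_red lie_red_mu lie_confluent). Qed.

Lemma lie_nf_normal w : sorted <=%O w -> (forall i, i \in w -> ~ I0 i) ->
  lie_nf w = << w >>.
Proof.
move=> w_sorted wI0; apply: nf_irreducible => -[h rh].
case: rh w_sorted wI0 => [u v i j ij|u v p I0p]; first by rewrite sorted_descent.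
by move=> _ /(_ p); case=> //; rewrite mem_cat inE eqxx orbT.
Qed.

Lemma lie_nf_supp w v : v \in msupp (lie_nf w) ->
  sorted <=%O v /\ forall i, i \in v -> ~ I0 i.
Proof.
move/(nf_supp lie_red_mu) => irr; split.
  apply: contrapT => /negP/unsorted_descent[u [u' [i [j [ij def_v]]]]].
  by apply: irr; rewrite def_v; eexists; apply: LieSwap.
move=> i /path.splitPr v_split I0i; case: v_split irr => u u'; apply.
by eexists; apply: LieKill.
Qed.

End LieWords.

Arguments insert {k L d I} x {V} F u a v.
Arguments lie_red {k L d I} x I0 _ _.
Arguments lie_nf {k L d I} x I0 _.

(** * Functionals vanishing on the ideal of the enveloping dialgebra *)
Lemma lincomb_bilin (k : fieldType) (X : choiceType) (V : lmodType k)
    (op : diword X -> diword X -> diword X) (F : diword X -> V)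
    (f g : {malg k[diword X]}) :
  lincomb F (bilin op f g) = lincomb (fun u => lincomb (fun v => F (op u v)) g) f.
Proof.
rewrite /bilin linearP_sum; last exact: lincomb_linear.
apply: eq_bigr => u _; rewrite linearP_sum; last exact: lincomb_linear.
rewrite [in RHS]/lincomb scaler_sumr; apply: eq_bigr => v _.
by rewrite lincombU scalerA.
Qed.

Section Functionals.
Context {k : fieldType} {L : leibnizType k} {d : Order.disp_t} {I : orderType d}.
Context {x : I -> L} {I0 : set I}.
Context (x_basis : is_basis [set: I] x [set: L]).
Context (x_basis0 : is_basis I0 x (leibniz_kernel L)).
Context {V : lmodType k}.
Local Notation D := (free_dialg k I).
Local Notation "{{ i , j }}" := (bracket (x i) (x j)).
Implicit Types (u v w r l : seq I) (i j p m : I) (a b : L).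
Implicit Types (q : L -> seq I -> V).

(* The functionals factoring through the enveloping algebra of [L / L_0]. *)
Definition lie_functional (F : seq I -> V) : Prop :=
  (forall u v i j,
    F (u ++ j :: i :: v) = F (u ++ i :: j :: v) - insert x F u {{i, j}} v) /\
  (forall u v p, I0 p -> F (u ++ p :: v) = 0).

(** The maps from the tensor product of L and A to [V], as functions of a vector and a word. *)
Definition tensor_functional q : Prop :=
  (forall r, linear (q^~ r)) /\ (forall a, lie_functional (q a)).

(* The transpose of the left action
   x_j (a (x) r) = a (x) x_j r - {a, x_j} (x) r
   on the tensor product of L with the enveloping algebra. *)
Definition shift q j : L -> seq I -> V :=
  fun a r => q a (j :: r) - q (bracket a (x j)) r.

(** The leftmost letter acts last on the model, so its transpose is applied to [q] first; hence
    [foldl]. *)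
Definition act q l : L -> seq I -> V := foldl shift q l.

Definition diword_functional q (w : diword I) : V :=
  act q (dleft w) (x (dcenter w)) (dright w).

Lemma lie_functional_cat F u v :
  lie_functional F -> lie_functional (fun r => F (u ++ r ++ v)).
Proof.
case=> Fswap Fkill; split=> [u' v' i j|u' v' p I0p].
  rewrite -[(u' ++ _) ++ v]catA catA [LHS]Fswap -!catA; congr (_ - _).
  by apply: eq_lincomb => m _; rewrite -!catA.
by rewrite -catA catA Fkill.
Qed.

Lemma lie_functional_sub F G : lie_functional F -> lie_functional G ->
  lie_functional (fun r => F r - G r).
Proof.
move=> [Fs Fk] [Gs Gk]; split=> [u v i j|u v p I0p].
  by rewrite Fs Gs /insert lincombBl !opprD addrACA !opprK.
by rewrite Fk // Gk // subrr.
Qed.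

Lemma tensor_functional_shift q j : tensor_functional q -> tensor_functional (shift q j).
Proof.
move=> [ql qF]; split=> [r|a].
  apply: linear_sub; first exact: ql.
  exact: linear_comp (ql r) (bracket_linearl (x j)).
apply: lie_functional_sub => //.
split=> [u v i i'|u v p I0p]; first exact: ((qF a).1 (j :: u)).
exact: ((qF a).2 (j :: u)).
Qed.

Lemma tensor_functional_act q l : tensor_functional q -> tensor_functional (act q l).
Proof.
by elim: l q => //= j l IH q qT; apply: IH; apply: tensor_functional_shift.
Qed.

Lemma act_cat q l l' : act q (l ++ l') = act (act q l) l'.
Proof. exact: foldl_cat. Qed.

Lemma act_catr q l v a r :
  act (fun a r => q a (r ++ v)) l a r = act q l a (r ++ v).
Proof. by elim: l q => //= j l IH q; rewrite -IH. Qed.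

(** Carries a relation between functionals through the letters that still have to act. *)
Lemma act_comb q q' (G : I -> L -> seq I -> V) c l a r :
  (forall a r, q a r = q' a r - lincomb (fun m => G m a r) c) ->
  act q l a r = act q' l a r - lincomb (fun m => act (G m) l a r) c.
Proof.
elim: l q q' G a r => //= j l IH q q' G a r qG; apply: IH => {}a {}r.
by rewrite /shift !qG lincombBl !opprD addrACA opprK.
Qed.

Lemma act_zero q l a r : (forall a r, q a r = 0) -> act q l a r = 0.
Proof.
elim: l q a r => //= j l IH q a r q0; apply: IH => {}a {}r.
by rewrite /shift !q0 subr0.
Qed.

(* The Leibniz identity makes the left action a Lie action. *)
Lemma shift_comm q i j a r : tensor_functional q ->
  shift (shift q j) i a r =
  shift (shift q i) j a r - lincomb (fun m => shift q m a r) (coords x {{i, j}}).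
Proof.
move=> [ql qF]; rewrite /shift lincombBl.
have -> : lincomb (fun m => q (bracket a (x m)) r) (coords x {{i, j}}) =
    q (bracket a {{i, j}}) r.
  have linq : linear (fun b => q (bracket a b) r).
    exact: linear_comp (ql r) (bracket_linearr a).
  by have := linearP_lincomb x (coords x {{i, j}}) linq; rewrite (coordsK x_basis) => /= ->.
have := (qF a).1 [::] r i j; rewrite /= /insert /= => ->.
have -> : q (bracket (bracket a (x i)) (x j)) r =
    q (bracket (bracket a (x j)) (x i)) r + q (bracket a {{i, j}}) r.
  by rewrite leibniz_identity (linearPD (ql r)).
by rewrite !opprB !addrA [LHS](ACl (1*6*4*3*5*2)).
Qed.

(** The left action of words factors through A: swaps by [shift_comm], and a letter p of [I0] acts
    as 0 since both {b, x_p} and p itself vanish in the model. *)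
Lemma lie_functional_act q l a r : tensor_functional q ->
  lie_functional (fun w => act q (w ++ l) a r).
Proof.
move=> qT; split=> [u v i j|u v p I0p].
  rewrite -!catA !cat_cons !(act_cat q u); set Q := act q u.
  have comm b s : shift (shift Q j) i b s =
      shift (shift Q i) j b s - lincomb (fun m => shift Q m b s) (coords x {{i, j}}).
    exact/shift_comm/tensor_functional_act.
  rewrite [LHS](act_comb _ _ _ comm) /insert; congr (_ - _).
  by apply: eq_lincomb => m _; rewrite -catA (act_cat q u).
rewrite -catA (act_cat q u); change (act (shift (act q u) p) (v ++ l) a r = 0).
have [Ql QF] := tensor_functional_act u qT.
apply: act_zero => b s; rewrite /shift (bracket_kernelr _ (kernelI0 x_basis0 I0p)).
by rewrite (linearP0 (Ql s)) subr0; apply: (QF b).2 [::] s p I0p.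
Qed.

(** The second condition makes the set an ideal: it handles f ⊢ g and g ⊣ f, where the center of f
    is lost, while the first handles g ⊢ f and f ⊣ g on the tensor product. *)
Definition functional_kernel : set D := [set f |
  (forall q, tensor_functional q -> lincomb (diword_functional q) f = 0) /\
  (forall F, lie_functional F -> lincomb (fun w : diword I => F (word w)) f = 0)].

Lemma word_vdash (u v : diword I) : word (diword_vdash u v) = word u ++ word v.
Proof. by rewrite /word /= -!catA. Qed.

Lemma word_dashv (u v : diword I) : word (diword_dashv u v) = word u ++ word v.
Proof. by rewrite /word /= -!catA. Qed.

Lemma functional_kernel_ideal : is_ideal functional_kernel.
Proof.
split=> [|t f g [f1 f2] [g1 g2]|f g [f1 f2]].
- by split=> *; apply: lincomb0r.
- split=> [q qT|F FF].
    rewrite (lincomb_linear (diword_functional q) t f g).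
    by rewrite f1 // g1 // scaler0 addr0.
  rewrite (lincomb_linear (fun w : diword I => F (word w)) t f g).
  by rewrite f2 // g2 // scaler0 addr0.
have f2l F v : lie_functional F -> lincomb (fun w : diword I => F (word w ++ v)) f = 0.
  by move=> FF; apply: (f2 (fun r => F (r ++ v))); apply: (lie_functional_cat [::] v).
have f2r F u : lie_functional F -> lincomb (fun w : diword I => F (u ++ word w)) f = 0.
  move=> FF; apply: (f2 (fun r => F (u ++ r))).
  by have := lie_functional_cat u [::] FF; congr lie_functional; apply/funext => r; rewrite cats0.
have zero (J : choiceType) (c : {malg k[J]}) (F : J -> V) : (forall y, F y = 0) -> lincomb F c = 0.
  by move=> F0; rewrite -[RHS](lincomb0 c); apply: eq_lincomb => y _; apply: F0.
have tr q v : tensor_functional q -> tensor_functional (fun a r => q a (r ++ v)).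
  move=> [ql qF]; split=> [r|a]; first exact: ql.
  exact: lie_functional_cat [::] v (qF a).
split; split=> [q qT|F FF].
- rewrite lincomb_bilin lincomb_exchange; apply: zero => v.
  exact: f2 (lie_functional_act (dleft v) (x (dcenter v)) (dright v) qT).
- rewrite lincomb_bilin lincomb_exchange; apply: zero => v.
  by under eq_lincomb do rewrite word_vdash; apply: f2l.
- rewrite lincomb_bilin; apply: zero => u.
  rewrite -[RHS](f1 (act q (word u))); last exact: tensor_functional_act.
  by apply: eq_lincomb => v _; rewrite /diword_functional /= act_cat.
- rewrite lincomb_bilin; apply: zero => u.
  by under eq_lincomb do rewrite word_vdash; apply: f2r.
- rewrite lincomb_bilin lincomb_exchange; apply: zero => v.
  rewrite -[RHS](f1 (fun a r => q a (r ++ word v))); last exact: tr.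
  by apply: eq_lincomb => u _; rewrite /diword_functional /= act_catr.
- rewrite lincomb_bilin lincomb_exchange; apply: zero => v.
  by under eq_lincomb do rewrite word_dashv; apply: f2l.
- rewrite lincomb_bilin; apply: zero => u.
  exact: f2r (dright u) ((tensor_functional_act (dleft u) qT).2 (x (dcenter u))).
- rewrite lincomb_bilin; apply: zero => u.
  by under eq_lincomb do rewrite word_dashv; apply: f2r.
Qed.

End Functionals.

Arguments lie_functional {k L d I} x I0 {V} F.
Arguments tensor_functional {k L d I} x I0 {V} q.
Arguments diword_functional {k L d I} x {V} q w.
Arguments functional_kernel {k L d I} x I0 V _.

(** * The universal enveloping dialgebra *)
Section FreeMonomials.
Context {k : fieldType} {X : choiceType}.
Local Notation D := (free_dialg k X).

Lemma vdash_monomial (u v : diword X) :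
  (<< u >> : D) ⊢ (<< v >> : D) = << diword_vdash u v >>.
Proof. by rewrite [LHS]bilinUU mulr1. Qed.

Lemma dashv_monomial (u v : diword X) :
  (<< u >> : D) ⊣ (<< v >> : D) = << diword_dashv u v >>.
Proof. by rewrite [LHS]bilinUU mulr1. Qed.

Lemma free_lincomb_linear (V : lmodType k) (F : diword X -> V) :
  linear (fun f : D => lincomb F f).
Proof. exact: lincomb_linear. Qed.

Lemma free_lincombB (V : lmodType k) (F : diword X -> V) (f g : D) :
  lincomb F (f - g) = lincomb F f - lincomb F g.
Proof. exact: (linearPB (free_lincomb_linear F)). Qed.

Lemma free_lincombD (V : lmodType k) (F : diword X -> V) (f g : D) :
  lincomb F (f + g) = lincomb F f + lincomb F g.
Proof. exact: (linearPD (free_lincomb_linear F)). Qed.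

Lemma free_lincomb_lincomb (V : lmodType k) (J : choiceType) (F : diword X -> V)
    (e : J -> D) c : lincomb F (lincomb e c) = lincomb (fun j => lincomb F (e j)) c.
Proof. exact: (linearP_lincomb e c (free_lincomb_linear F)). Qed.

Lemma free_linearE (V : lmodType k) (f : D -> V) (g : D) :
  linear f -> f g = lincomb (fun u => f << u >>) g.
Proof. exact: linear_malgE. Qed.

End FreeMonomials.

Section Commutators.
Context {k : fieldType} {D : dialgType k}.
Implicit Types a b y : D.

(** To the left of ⊢ both products coincide, so the Leibniz bracket acts there as an ordinary
    commutator. Relation (b) is this identity, and (c) follows because squares and symmetrized
    brackets act as 0; (d) and (e) are the mirror images. *)
Lemma commutator_vdash a b y : (a ⊣ b - b ⊢ a) ⊢ y = a ⊢ b ⊢ y - b ⊢ a ⊢ y.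
Proof. by rewrite vdashDl vdashNl vdash_dashv. Qed.

Lemma dashv_commutator a b y : y ⊣ (a ⊣ b - b ⊢ a) = y ⊣ a ⊣ b - y ⊣ b ⊣ a.
Proof. by rewrite dashvDr dashvNr dashv_vdash dashvA. Qed.

Lemma commutator_sq_vdash a y : (a ⊣ a - a ⊢ a) ⊢ y = 0.
Proof. by rewrite commutator_vdash subrr. Qed.

Lemma dashv_commutator_sq a y : y ⊣ (a ⊣ a - a ⊢ a) = 0.
Proof. by rewrite dashv_commutator subrr. Qed.

Lemma commutator_sym_vdash a b y : (a ⊣ b - b ⊢ a + (b ⊣ a - a ⊢ b)) ⊢ y = 0.
Proof. by rewrite vdashDl !commutator_vdash subrKA subrr. Qed.

Lemma dashv_commutator_sym a b y : y ⊣ (a ⊣ b - b ⊢ a + (b ⊣ a - a ⊢ b)) = 0.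
Proof. by rewrite dashvDr !dashv_commutator subrKA subrr. Qed.

End Commutators.

Section DialgebraMorphism.
Context {k : fieldType} {D E : dialgType k} (p : D -> E).
Hypotheses (p_linear : linear p) (p_vdash : forall a b, p (a ⊢ b) = p a ⊢ p b).
Hypothesis p_dashv : forall a b, p (a ⊣ b) = p a ⊣ p b.
Implicit Types a b c t : D.

Lemma morphism_relation_a a b c : p c = p b ⊣ p a - p a ⊢ p b ->
  p (a ⊢ b - b ⊣ a + c) = 0.
Proof.
move=> pc; rewrite (linearPD p_linear) (linearPB p_linear) p_vdash p_dashv pc.
by rewrite addrA subrK subrr.
Qed.

Lemma morphism_relation_b a b c t : p c = p b ⊣ p a - p a ⊢ p b ->
  p (a ⊢ b ⊢ t - b ⊢ a ⊢ t + c ⊢ t) = 0.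
Proof.
move=> pc; rewrite (linearPD p_linear) (linearPB p_linear) !p_vdash pc.
by rewrite commutator_vdash addrA subrK subrr.
Qed.

Lemma morphism_relation_d a b c t : p c = p b ⊣ p a - p a ⊢ p b ->
  p (t ⊣ a ⊣ b - t ⊣ b ⊣ a + t ⊣ c) = 0.
Proof.
move=> pc; rewrite (linearPD p_linear) (linearPB p_linear) !p_dashv pc.
by rewrite dashv_commutator addrA subrK subrr.
Qed.

Lemma morphism_foldl (r : seq D) c : foldl dashv (p c) (map p r) = p (foldl dashv c r).
Proof. by elim: r c => //= a r IH c; rewrite -p_dashv IH. Qed.

End DialgebraMorphism.

Section EnvelopingDialgebra.
Context {k : fieldType} {L : leibnizType k} {d : Order.disp_t} {I : orderType d}.
Context {x : I -> L} {I0 : set I}.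
Context (x_basis : is_basis [set: I] x [set: L]).
Context (x_basis0 : is_basis I0 x (leibniz_kernel L)).
Local Notation D := (free_dialg k I).
Local Notation U := (enveloping x).
Local Notation "''x_' i" := (gen k i) (at level 8, i at level 2).
Local Notation pi := (enveloping_pi x).
Local Notation "{{ i , j }}" := (bracket (x i) (x j)).
Implicit Types (i j t m : I) (a b : L) (f g : D).

Lemma pi_linear : linear pi.
Proof. by move=> t f g; rewrite /enveloping_pi dialg_piD dialg_piZ. Qed.

Lemma pi_vdash f g : pi (f ⊢ g) = pi f ⊢ pi g.
Proof. exact/esym/quot_vdashE. Qed.

Lemma pi_dashv f g : pi (f ⊣ g) = pi f ⊣ pi g.
Proof. exact/esym/quot_dashvE. Qed.

Lemma pi_eq0 f : pi f = 0 <-> Id (enveloping_relations x) f.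
Proof.
rewrite -(linearP0 pi_linear) /enveloping_pi dialg_piP.
by rewrite subr0.
Qed.

Lemma lin_poly_linear : linear (lin_poly x).
Proof. exact: coords_lincomb_linear. Qed.

Lemma lin_poly_basis i : lin_poly x (x i) = 'x_i.
Proof. by rewrite /lin_poly (coords_basis x_basis) lincombU1. Qed.

Definition enveloping_vec a : U := pi (lin_poly x a).

Lemma enveloping_vec_basis i : enveloping_vec (x i) = pi 'x_i.
Proof. by rewrite /enveloping_vec lin_poly_basis. Qed.

Lemma enveloping_vec_linear : linear enveloping_vec.
Proof. exact: linear_comp pi_linear lin_poly_linear. Qed.

Lemma enveloping_vec_bracket a b : enveloping_vec (bracket a b) =
  enveloping_vec a ⊣ enveloping_vec b - enveloping_vec b ⊢ enveloping_vec a.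
Proof.
move: a; apply: (linear_basis_ext x_basis).
- exact: linear_comp enveloping_vec_linear (bracket_linearl b).
- apply: linear_sub; first exact:
    linear_comp (dashv_linearl (enveloping_vec b)) enveloping_vec_linear.
  exact: linear_comp (vdash_linearr (enveloping_vec b)) enveloping_vec_linear.
move=> i; move: b; apply: (linear_basis_ext x_basis).
- exact: linear_comp enveloping_vec_linear (bracket_linearr (x i)).
- apply: linear_sub; first exact:
    linear_comp (dashv_linearr (enveloping_vec (x i))) enveloping_vec_linear.
  exact: linear_comp (vdash_linearl (enveloping_vec (x i))) enveloping_vec_linear.
move=> j; rewrite !enveloping_vec_basis -pi_dashv -pi_vdash -!(linearPB pi_linear) /enveloping_vec.
apply/esym/eqP; rewrite -subr_eq0 -(linearPB pi_linear); apply/eqP/pi_eq0.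
by apply: sub_gen_smallest; exists i, j.
Qed.

Lemma pi_bracket_basis i j :
  pi (lin_poly x {{i, j}}) = pi 'x_i ⊣ pi 'x_j - pi 'x_j ⊢ pi 'x_i.
Proof. by have := enveloping_vec_bracket (x i) (x j); rewrite !enveloping_vec_basis. Qed.

Lemma enveloping_vec_kernel_vdash a (y : U) : leibniz_kernel L a -> enveloping_vec a ⊢ y = 0.
Proof.
move: a; apply: leibniz_kernel_ind => [|a|a b].
- exact: lin_closed_ker (linear_comp (vdash_linearl y) enveloping_vec_linear).
- by rewrite enveloping_vec_bracket; apply: commutator_sq_vdash.
- by rewrite (linearPD enveloping_vec_linear) !enveloping_vec_bracket; apply: commutator_sym_vdash.
Qed.

Lemma enveloping_vec_kernel_dashv a (y : U) : leibniz_kernel L a -> y ⊣ enveloping_vec a = 0.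
Proof.
move: a; apply: leibniz_kernel_ind => [|a|a b].
- exact: lin_closed_ker (linear_comp (dashv_linearr y) enveloping_vec_linear).
- by rewrite enveloping_vec_bracket; apply: dashv_commutator_sq.
- by rewrite (linearPD enveloping_vec_linear) !enveloping_vec_bracket; apply: dashv_commutator_sym.
Qed.

Lemma Id_sub (S S' : set D) : (forall f, S f -> Id S' f) -> Id S `<=` Id S'.
Proof. by move=> SS'; apply: smallest_sub => //; apply: Id_ideal. Qed.

Lemma gsb_sub_relations f : enveloping_gsb x I0 f -> Id (enveloping_relations x) f.
Proof.
move=> Sf; apply/pi_eq0; have pl := pi_linear.
case: Sf => [i j|i j t ij|i0 t Ii0|i j t ij|i0 t Ii0].
- by apply: (morphism_relation_a pl pi_vdash pi_dashv); apply: pi_bracket_basis.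
- by apply: (morphism_relation_b pl pi_vdash); apply: pi_bracket_basis.
- have := enveloping_vec_kernel_vdash (pi 'x_t) (kernelI0 x_basis0 Ii0).
  by rewrite enveloping_vec_basis -pi_vdash.
- by apply: (morphism_relation_d pl pi_dashv); apply: pi_bracket_basis.
- have := enveloping_vec_kernel_dashv (pi 'x_t) (kernelI0 x_basis0 Ii0).
  by rewrite enveloping_vec_basis -pi_dashv.
Qed.

Lemma relations_sub_gsb f : enveloping_relations x f -> Id (enveloping_gsb x I0) f.
Proof.
move=> [i [j ->]]; have [I_0 IZD _] := Id_ideal (enveloping_gsb x I0).
have Pl : lin_closed (Id (enveloping_gsb x I0)) by split.
have Sa : Id (enveloping_gsb x I0) ('x_j ⊢ 'x_i - 'x_i ⊣ 'x_j + lin_poly x {{i, j}}).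
  by apply: sub_gen_smallest; apply: GSB_a.
by have := lin_closedN Pl Sa; rewrite opprD opprB.
Qed.

Lemma Id_relations_gsb : Id (enveloping_relations x) = Id (enveloping_gsb x I0).
Proof.
rewrite eqEsubset; split; apply: Id_sub; first exact: relations_sub_gsb.
exact: gsb_sub_relations.
Qed.

Lemma lincomb_lin_poly (V : lmodType k) (F : diword I -> V) a :
  lincomb F (lin_poly x a) = lincomb (fun m => F (letter m)) (coords x a).
Proof.
rewrite /lin_poly free_lincomb_lincomb; apply: eq_lincomb => m _.
exact: lincombU1.
Qed.

Lemma lincomb_relation (V : lmodType k) (F : diword I -> V) i j a :
  lincomb F ('x_i ⊣ 'x_j - 'x_j ⊢ 'x_i - lin_poly x a) =
  F (Diword [::] i [:: j]) - F (Diword [:: j] i [::]) -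
  lincomb (fun m => F (letter m)) (coords x a).
Proof.
rewrite free_lincombB free_lincombB lincomb_lin_poly; congr (_ - _ - _).
  by rewrite [X in lincomb F X]dashv_monomial lincombU1.
by rewrite [X in lincomb F X]vdash_monomial lincombU1.
Qed.

(** Since [functional_kernel] is an ideal, the defining relations suffice. On them the definition of
    [shift] and the swap relation for words give 0 directly. *)
Lemma relations_functional_kernel (V : lmodType k) f : Id (enveloping_relations x) f ->
  functional_kernel x I0 V f.
Proof.
apply: smallest_sub; first exact: functional_kernel_ideal.
move=> _ [i [j ->]]; split=> [q [ql qF]|F [Fs _]]; rewrite lincomb_relation.
  rewrite /diword_functional /= /shift /=.
  have := linearP_lincomb x (coords x {{i, j}}) (ql [::]).
  rewrite (coordsK x_basis) => /= ->.
  by rewrite opprB addrCA subrr addr0 subrr.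
by rewrite /word /= (Fs [::] [::] i j) opprB addrCA subrr addr0 subrr.
Qed.

End EnvelopingDialgebra.

Section IdealChains.
Context {k : fieldType} {E : dialgType k} (J : set E).
Hypothesis J_ideal : is_ideal J.
Implicit Types (l r : seq E) (c s : E).

Lemma ideal_foldr l c : J c -> J (foldr vdash c l).
Proof.
have [_ _ JM] := J_ideal.
by elim: l => //= a l IH /IH Jc; have [] := JM _ a Jc.
Qed.

Lemma ideal_foldl r c : J c -> J (foldl dashv c r).
Proof.
have [_ _ JM] := J_ideal.
by elim: r c => //= a r IH c Jc; apply: IH; have [] := JM _ a Jc.
Qed.

Lemma ideal_foldr_mid l s l' c : J s -> J (foldr vdash c (l ++ s :: l')).
Proof.
have [_ _ JM] := J_ideal; move=> Js; rewrite foldr_cat; apply: ideal_foldr => /=.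
by have [] := JM _ (foldr vdash c l') Js.
Qed.

Lemma ideal_foldl_mid r s r' c : J s -> J (foldl dashv c (r ++ s :: r')).
Proof.
have [_ _ JM] := J_ideal; move=> Js; rewrite foldl_cat /=; apply: ideal_foldl.
by have [] := JM _ (foldl dashv c r) Js.
Qed.

End IdealChains.

(** * Deg-lex ordering and s-diwords *)
Section Fill.
Context {X : Type}.
Implicit Types (w : diword X) (C : dcontext X).

Lemma foldr_vdash_letters l w :
  foldr (@diword_vdash X) w (map (@letter X) l) =
  Diword (l ++ dleft w) (dcenter w) (dright w).
Proof. by elim: l => [|i l /= ->]; [case: w | rewrite /diword_vdash]. Qed.

Lemma foldl_dashv_letters r w :
  foldl (@diword_dashv X) w (map (@letter X) r) =
  Diword (dleft w) (dcenter w) (dright w ++ r).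
Proof.
by elim: r w => [|i r IH] w /=; [case: w => ? ? ?; rewrite cats0 | rewrite IH /= -catA].
Qed.

Lemma fill_diwordE C w : fill_diword C w =
  match C with
  | AtCenter a b => Diword (a ++ dleft w) (dcenter w) (dright w ++ b)
  | LeftOfCenter a a' c b => Diword (a ++ word w ++ a') c b
  | RightOfCenter a c b' b => Diword a c (b' ++ word w ++ b)
  end.
Proof.
case: C => [a b|a a' c b|a c b' b]; rewrite /fill_diword /= /dichain.
- by rewrite foldl_dashv_letters foldr_vdash_letters.
- rewrite foldr_cat /= foldl_dashv_letters foldr_vdash_letters foldr_vdash_letters /=.
  by rewrite cats0.
- rewrite foldl_cat /= foldl_dashv_letters foldl_dashv_letters foldr_vdash_letters /=.
  by rewrite cats0 -catA.
Qed.

Lemma word_fill C w : word (fill_diword C w) = prefix_word C ++ word w ++ suffix_word C.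
Proof.
by rewrite fill_diwordE; case: C => *; rewrite /word /= -?catA //= -?catA.
Qed.

End Fill.

Section Deglex.
Context {d : Order.disp_t} {X : orderType d}.
Implicit Types (u v w : diword X) (C : dcontext X) (s t : seq X).

Lemma deglex_leE v w : deglex_le v w =
  (dsize v < dsize w)%N || (dsize v == dsize w) &&
  ((size (dleft v) < size (dleft w))%N || (size (dleft v) == size (dleft w)) &&
   (word v <= word w :> seqlexi X)%O).
Proof.
rewrite /deglex_le /wt !Order.ProdLexiOrder.leEprodlexi /= !leEnat.
by case: (ltngtP (dsize v)) => //= _; case: (ltngtP (size (dleft v))).
Qed.

Lemma wt_inj : injective (@wt d X).
Proof.
case=> [l c r] [l' c' r'] eq_wt.
have eq_size : size l = size l' by apply: (congr1 (fun p => p.2.1) eq_wt).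
have /eqP : l ++ c :: r = l' ++ c' :: r' by apply: (congr1 (fun p => p.2.2) eq_wt).
by rewrite eqseq_cat // => /andP[/eqP -> /eqP[-> ->]].
Qed.

Lemma deglex_ltE v w : deglex_lt v w =
  (dsize v < dsize w)%N || (dsize v == dsize w) &&
  ((size (dleft v) < size (dleft w))%N || (size (dleft v) == size (dleft w)) &&
   (word v < word w :> seqlexi X)%O).
Proof.
rewrite /deglex_lt /wt !Order.ProdLexiOrder.ltEprodlexi /= !leEnat.
by case: (ltngtP (dsize v)) => //= _; case: (ltngtP (size (dleft v))).
Qed.

Lemma deglex_lt_neqAle v w : deglex_lt v w = (v != w) && deglex_le v w.
Proof. by rewrite /deglex_lt lt_neqAle (inj_eq wt_inj). Qed.

Lemma deglex_refl v : deglex_le v v.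
Proof. exact: le_refl. Qed.

Lemma deglex_irr v : deglex_lt v v = false.
Proof. exact: ltxx. Qed.

Lemma deglex_le_trans : transitive (@deglex_le d X).
Proof. by move=> v u w; apply: le_trans. Qed.

Lemma deglex_ltW v w : deglex_lt v w -> deglex_le v w.
Proof. exact: ltW. Qed.

Lemma deglex_le_lt_trans v u w : deglex_le u v -> deglex_lt v w -> deglex_lt u w.
Proof. exact: le_lt_trans. Qed.

Lemma deglex_anti v w : deglex_le v w -> deglex_le w v -> v = w.
Proof. by move=> vw wv; apply: wt_inj; apply/eqP; rewrite eq_le [X in X && _]vw. Qed.

Lemma deglex_total v w : deglex_le v w || deglex_le w v.
Proof. exact: le_total. Qed.

Lemma deglex_dsize v w : deglex_le v w -> (dsize v <= dsize w)%N.
Proof. by rewrite deglex_leE => /orP[/ltnW //|/andP[/eqP -> _]]. Qed.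

Lemma deglex_lt_dsize v w : (dsize v < dsize w)%N -> deglex_lt v w.
Proof. by rewrite deglex_ltE => ->. Qed.

(** Equal lengths matter: if [s] were a proper prefix of [t], appending [z] could reverse the
    comparison. *)
Lemma seqlexi_cat_lt (p s t z : seq X) : size s = size t ->
  (s < t :> seqlexi X)%O -> (p ++ s ++ z < p ++ t ++ z :> seqlexi X)%O.
Proof.
move=> st lt_st; elim: p => [|i p IH] /=; last by rewrite eqhead_ltxiE.
elim: s t st lt_st => [|i s IH] [|j t] //= [st].
rewrite !Order.SeqLexiOrder.ltxi_cons => /andP[-> /implyP lt_st] /=.
by apply/implyP => /lt_st; apply: IH.
Qed.

End Deglex.

Section FillOrder.
Context {d : Order.disp_t} {X : orderType d}.
Implicit Types (u v w : diword X) (C : dcontext X).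

Definition fits C w : Prop :=
  match C with
  | AtCenter _ _ => True
  | LeftOfCenter _ _ _ _ => dright w = [::]
  | RightOfCenter _ _ _ _ => dleft w = [::]
  end.

Lemma dsizeE w : dsize w = (size (dleft w) + (size (dright w)).+1)%N.
Proof. by rewrite /dsize size_cat. Qed.

(** A position beside the center forgets the center of the inserted diword, so a comparison decided
    by the letters left of that center would be lost. [fits] makes their number a function of the
    length, and only the comparison of words remains. *)
Lemma fill_deglex_lt C v w : fits C v -> fits C w -> deglex_lt v w ->
  deglex_lt (fill_diword C v) (fill_diword C w).
Proof.
move=> Cv Cw; rewrite !deglex_ltE.
have size_fill u : dsize (fill_diword C u) =
    (size (prefix_word C) + dsize u + size (suffix_word C))%N.
  by rewrite /dsize word_fill !size_cat addnA.
rewrite !size_fill ltn_add2r ltn_add2l eqn_add2r eqn_add2l => /orP[-> //|].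
move=> /andP[size_vw lex_vw]; rewrite size_vw /=; apply/orP; right.
have lex_fill : (word v < word w :> seqlexi X)%O ->
    (word (fill_diword C v) < word (fill_diword C w) :> seqlexi X)%O.
  by rewrite !word_fill; apply: seqlexi_cat_lt; apply/eqP.
move: Cv Cw lex_vw lex_fill; rewrite !fill_diwordE.
case: C {size_fill} => [a b|a a' c b|a c b' b] /= Cv Cw lex_vw lex_fill.
- rewrite !size_cat ltn_add2l eqn_add2l; case/orP: lex_vw => [-> //|].
  by case/andP=> -> /lex_fill ->; rewrite orbT.
- have eq_left : size (dleft v) = size (dleft w).
    by move/eqP: size_vw; rewrite !dsizeE Cv Cw /= !addn1 => -[].
  have -> : size (a ++ word v ++ a') = size (a ++ word w ++ a').
    by move/eqP: size_vw; rewrite /dsize !size_cat; lia.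
  by move: lex_vw; rewrite eq_left !ltnn !eqxx /=.
- by move: lex_vw; rewrite Cv Cw !ltnn !eqxx /=.
Qed.

Context {k : fieldType}.
Local Notation D := (free_dialg k X).
Implicit Types (s f g : D).

Lemma leading_unique f v w : leading f v -> leading f w -> v = w.
Proof. by move=> [vf maxv] [wf maxw]; apply: deglex_anti; [apply: maxw|apply: maxv]. Qed.

Lemma leading_exists f : f != 0 -> exists w, leading f w.
Proof.
move=> f0; have [supp0|[w0 w0f]] := fset_0Vmem (msupp f).
  case/eqP: f0; apply/malgP => w; rewrite mcoeff_outdom ?supp0 ?in_fset0 //.
  exact/esym/mcoeff0.
suff [w wf maxw] : exists2 w, w \in enum_fset (msupp f) &
    forall v, v \in enum_fset (msupp f) -> deglex_le v w by exists w.
have : enum_fset (msupp f) != [::].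
  by apply/eqP => e; have : w0 \in enum_fset (msupp f) by []; rewrite e.
elim: (enum_fset _) => // v [|u r] IH _.
  by exists v; rewrite ?mem_head // => u; rewrite inE => /eqP ->; apply: deglex_refl.
have [//|w wr maxw] := IH; have [vw|wv] := orP (deglex_total v w).
  exists w; first by rewrite inE wr orbT.
  by move=> z; rewrite inE => /orP[/eqP -> //|/maxw].
exists v; first exact: mem_head.
move=> z; rewrite inE => /orP[/eqP ->|/maxw zw]; first exact: deglex_refl.
exact: deglex_le_trans zw wv.
Qed.

(** Leading diword [w] with coefficient 1, put as a support condition so that it can be checked term
    by term on linear combinations. *)
Definition monic_at s w : Prop :=
  forall v, v \in msupp (s - << w >>) -> deglex_lt v w.

Lemma monic_atP s w : leading s w /\ s@_w = 1 <-> monic_at s w.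
Proof.
split=> [[[ws maxw] s1] v|mw].
  rewrite -mcoeff_neq0 mcoeffB mcoeffU; case: (eqVneq w v) => [<-|wv].
    by rewrite s1 subrr eqxx.
  rewrite subr0 mcoeff_neq0 => /maxw le_vw.
  by rewrite deglex_lt_neqAle eq_sym wv.
have s1 : s@_w = 1.
  have : w \notin msupp (s - << w >>) by apply/negP => /mw; rewrite deglex_irr.
  by rewrite -mcoeff_eq0 mcoeffB mcoeffUU subr_eq0 => /eqP.
split=> //; split; first by rewrite -mcoeff_neq0 s1 oner_neq0.
move=> v vs; case: (eqVneq w v) => [<-|wv]; first exact: deglex_refl.
apply/deglex_ltW/mw; rewrite -mcoeff_neq0 mcoeffB mcoeffU (negbTE wv) subr0.
by rewrite mcoeff_neq0.
Qed.

Lemma monic_at_dmonic s w : monic_at s w -> dmonic s.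
Proof. by case/monic_atP => ? ?; exists w. Qed.

Lemma dmonic_at s w : dmonic s -> leading s w -> monic_at s w.
Proof.
by move=> [v sv s1] sw; apply/monic_atP; rewrite -(leading_unique sv sw).
Qed.

Lemma monic_at_sub f g w : monic_at f w -> monic_at g w ->
  forall v, v \in msupp (f - g) -> deglex_lt v w.
Proof.
move=> mf mg; rewrite -[f](subrK (<< w >> : D)) -addrA -[<< w >> - g]opprB.
by apply: (lin_closedB (msupp_closed (k := k) (fun v => deglex_lt v w))).
Qed.

Lemma linear_foldr_vdash (l : seq D) : linear (fun c => foldr vdash c l).
Proof.
elim: l => [|a l IH] t c c' //=.
by rewrite IH vdash_linearr.
Qed.

Lemma linear_foldl_dashv (r : seq D) : linear (fun c => foldl dashv c r).
Proof.
by elim: r => [|a r IH] t c c' //=; rewrite dashv_linearl IH.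
Qed.

Lemma sdiword_linear C : linear (sdiword C : D -> D).
Proof.
case: C => [a b|a a' c b|a c b' b]; rewrite /sdiword /fill /dichain.
- exact: linear_comp (linear_foldr_vdash _) (linear_foldl_dashv _).
- move=> t s s'; rewrite !foldr_cat /=.
  exact: linear_comp (linear_foldr_vdash _) (vdash_linearl _) t s s'.
- move=> t s s'; rewrite !foldl_cat /=.
  apply: (linear_comp (linear_foldr_vdash _)
    (linear_comp (linear_foldl_dashv _) (dashv_linearr _))).
Qed.

Lemma dichain_monomial (l r : seq D) (l' r' : seq (diword X)) (w : diword X) :
  l = map (fun u => << u >>) l' -> r = map (fun u => << u >>) r' ->
  dichain vdash dashv l (<< w >> : D) r =
  << dichain (@diword_vdash X) (@diword_dashv X) l' w r' >>.
Proof.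
move=> -> ->; rewrite /dichain.
have foldlE : forall u, foldl dashv (<< u >> : D) (map (fun u => << u >>) r') =
    << foldl (@diword_dashv X) u r' >>.
  elim: r' => [//|v r' IH] u.
  rewrite -[RHS]/(<< foldl (@diword_dashv X) (diword_dashv u v) r' >>).
  by rewrite -IH -dashv_monomial.
rewrite foldlE; elim: l' => [//|u l' IH].
by rewrite -[RHS]vdash_monomial -IH.
Qed.

Lemma sdiword_monomial C (w : diword X) :
  sdiword C (<< w >> : D) = << fill_diword C w >>.
Proof.
have mapE (r : seq X) : map (@gen k X) r = map (fun u => << u >>) (map (@letter X) r).
  by rewrite -map_comp.
case: C => [a b|a a' c b|a c b' b]; rewrite /sdiword /fill_diword /fill.
- exact: dichain_monomial.
- by apply: dichain_monomial => //; rewrite map_cat /= -!mapE.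
- by apply: dichain_monomial => //; rewrite map_cat /= -!mapE.
Qed.

Lemma sdiwordE C s : sdiword C s = lincomb (fun w => << fill_diword C w >>) s.
Proof.
rewrite (free_linearE s (sdiword_linear C)); apply: eq_lincomb => w _.
exact: sdiword_monomial.
Qed.

Lemma normal_fits C s w : normal C s -> w \in msupp s -> fits C w.
Proof. by case: C => //= *; auto. Qed.

Lemma monic_at_sdiword C s w : normal C s -> w \in msupp s -> monic_at s w ->
  monic_at (sdiword C s) (fill_diword C w).
Proof.
move=> nCs ws mw; rewrite /monic_at -sdiword_monomial -(linearPB (sdiword_linear C)).
rewrite sdiwordE.
apply: (lin_closed_lincomb (msupp_closed (k := k) (fun v => deglex_lt v (fill_diword C w)))).
move=> v vs u; rewrite msuppU1_eq => /eqP ->; apply: fill_deglex_lt; last exact: mw.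
  apply: (normal_fits nCs); have := fsubsetP (msuppB_le _ _) _ vs.
  by rewrite in_fsetU msuppU1_eq => /orP[//|/eqP ->].
exact: (normal_fits nCs).
Qed.

Definition join_families T n m (F : 'I_n -> T) (G : 'I_m -> T) (i : 'I_(n + m)) : T :=
  match split i with inl i' => F i' | inr i' => G i' end.

Lemma sum_join_families (V : lmodType k) n m t (tf : 'I_n -> k) (tg : 'I_m -> k)
    (F : 'I_n -> V) (G : 'I_m -> V) :
  t *: (\sum_i tf i *: F i) + \sum_i tg i *: G i =
  \sum_i join_families (fun i => t * tf i) tg i *: join_families F G i.
Proof.
rewrite big_split_ord /= scaler_sumr; congr (_ + _); apply: eq_bigr => i _.
  by rewrite /join_families (unsplitK (inl i)) scalerA.
by rewrite /join_families (unsplitK (inr i)).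
Qed.

Lemma sum_of_sdiwords_closed (S : set D) P : lin_closed (sum_of_sdiwords S P).
Proof.
split; first by exists 0%N, (fun=> 0), (fun=> AtCenter [::] [::]), (fun=> 0);
  split; [case|rewrite big_ord0].
move=> t f g [n [tf [Cf [sf [Pf ->]]]]] [m [tg [Cg [sg [Pg ->]]]]].
exists (n + m)%N, (join_families (fun i => t * tf i) tg), (join_families Cf Cg),
  (join_families sf sg); split.
  by move=> i; rewrite /join_families; case: split.
rewrite [LHS]sum_join_families; apply: eq_bigr => i _; congr (_ *: _).
by rewrite /join_families; case: split.
Qed.

Lemma sum_of_sdiwords1 (S : set D) (P : dcontext X -> D -> Prop) C s :
  S s -> P C s -> sum_of_sdiwords S P (sdiword C s).
Proof.
move=> Ss PCs; exists 1%N, (fun=> 1), (fun=> C), (fun=> s).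
by rewrite big_ord1 scale1r.
Qed.

Lemma sum_of_sdiwordsS (S : set D) (P Q : dcontext X -> D -> Prop) f :
  (forall C s, S s -> P C s -> Q C s) ->
  sum_of_sdiwords S P f -> sum_of_sdiwords S Q f.
Proof.
move=> PQ [n [t [C [s [SP ->]]]]]; exists n, t, C, s; split=> // i.
by have [Ss Ps] := SP i; split=> //; apply: PQ.
Qed.

Lemma ideal_sdiword (J : set D) C s : is_ideal J -> J s -> J (sdiword C s).
Proof.
move=> JI Js; case: C => [a b|a a' c b|a c b' b]; rewrite /sdiword /fill /dichain.
- by apply: ideal_foldr => //; apply: ideal_foldl.
- exact: ideal_foldr_mid.
- by apply: ideal_foldr => //; apply: ideal_foldl_mid.
Qed.

End FillOrder.

(** * Reduction modulo the Groebner-Shirshov basis *)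
Section SwapPolynomials.
Context {k : fieldType} {d : Order.disp_t} {X : orderType d}.
Local Notation D := (free_dialg k X).
Implicit Types (w : diword X) (C : dcontext X) (phi : X -> diword X) (c : {malg k[X]}).

(* The common shape of the relations (a), (b) and (d). *)
Definition swap_poly w w' phi c : D :=
  (<< w >> : D) - << w' >> + lincomb (fun m => << phi m >> : D) c.

Lemma msupp_swap_poly (P : diword X -> Prop) w w' phi c :
  P w -> P w' -> (forall m, P (phi m)) ->
  forall v, v \in msupp (swap_poly w w' phi c) -> P v.
Proof.
move=> Pw Pw' Pphi; have Pl := msupp_closed (k := k) P.
have P1 u : P u -> forall v, v \in msupp (<< u >> : {malg k[diword X]}) -> P v.
  by move=> Pu v; rewrite msuppU1_eq => /eqP ->.
apply: (lin_closedD Pl); first by apply: (lin_closedB Pl); apply: P1.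
by apply: (lin_closed_lincomb Pl) => m _; apply: P1.
Qed.

Lemma monic_at_swap_poly w w' phi c : deglex_lt w' w ->
  (forall m, deglex_lt (phi m) w) -> monic_at (swap_poly w w' phi c) w.
Proof.
move=> lt_w' lt_phi; rewrite /monic_at.
have -> : swap_poly w w' phi c - << w >> =
    lincomb (fun m => << phi m >> : D) c - << w' >>.
  by rewrite /swap_poly addrAC [X in X + _]addrAC subrr add0r addrC.
have Pl := msupp_closed (k := k) (fun v => deglex_lt v w).
apply: (lin_closedB Pl); last by move=> v; rewrite msuppU1_eq => /eqP ->.
by apply: (lin_closed_lincomb Pl) => m _ v; rewrite msuppU1_eq => /eqP ->.
Qed.

Lemma lincomb_swap_poly (V : lmodType k) (F : diword X -> V) w w' phi c :
  lincomb F (swap_poly w w' phi c) = F w - F w' + lincomb (fun m => F (phi m)) c.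
Proof.
rewrite free_lincombD free_lincombB free_lincomb_lincomb; congr (_ - _ + _).
- exact: lincombU1.
- exact: lincombU1.
- by apply: eq_lincomb => m _; apply: lincombU1.
Qed.

Lemma sdiword_swap_poly C w w' phi c : sdiword C (swap_poly w w' phi c) =
  swap_poly (fill_diword C w) (fill_diword C w') (fun m => fill_diword C (phi m)) c.
Proof. by rewrite sdiwordE lincomb_swap_poly. Qed.

Lemma eq_swap_poly w1 w2 w1' w2' phi1 phi2 c : w1 = w2 -> w1' = w2' -> phi1 =1 phi2 ->
  swap_poly w1 w1' phi1 c = swap_poly w2 w2' phi2 c.
Proof. by move=> -> -> /funext ->. Qed.

Lemma dashv3_monomial (i j t : X) :
  gen k t ⊣ gen k j ⊣ gen k i = << Diword [::] t [:: j; i] >>.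
Proof. exact: etrans (congr1 (dashv^~ _) (dashv_monomial _ _)) (dashv_monomial _ _). Qed.

Lemma vdash3_monomial (i j t : X) :
  gen k j ⊢ gen k i ⊢ gen k t = << Diword [:: j; i] t [::] >>.
Proof. exact: etrans (congr1 (vdash^~ _) (vdash_monomial _ _)) (vdash_monomial _ _). Qed.

Lemma dashv_lincomb_gen t c :
  gen k t ⊣ lincomb (@gen k X) c = lincomb (fun m => << Diword [::] t [:: m] >>) c.
Proof.
apply: etrans (linearP_lincomb (@gen k X) c (dashv_linearr (gen k t))) _.
by apply: eq_lincomb => m _; apply: dashv_monomial.
Qed.

Lemma vdash_lincomb_gen t c :
  lincomb (@gen k X) c ⊢ gen k t = lincomb (fun m => << Diword [:: m] t [::] >>) c.
Proof.
apply: etrans (linearP_lincomb (@gen k X) c (vdash_linearl (gen k t))) _.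
by apply: eq_lincomb => m _; apply: vdash_monomial.
Qed.

End SwapPolynomials.

Section Reduction.
Context {k : fieldType} {L : leibnizType k} {d : Order.disp_t} {I : orderType d}.
Context {x : I -> L} {I0 : set I}.
Context (x_basis : is_basis [set: I] x [set: L]).
Context (x_basis0 : is_basis I0 x (leibniz_kernel L)).
Local Notation D := (free_dialg k I).
Local Notation S := (enveloping_gsb x I0).
Local Notation "{{ i , j }}" := (bracket (x i) (x j)).
Local Notation "''x_' i" := (gen k i) (at level 8, i at level 2).
Implicit Types (i j t m p : I) (a b : L) (f g h s : D) (u v w r l : seq I).
Implicit Types (C : dcontext I).

Definition relation_a i j : D :=
  swap_poly (Diword [:: j] i [::]) (Diword [::] i [:: j]) (@letter I) (coords x {{i, j}}).

Definition relation_b i j t : D :=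
  swap_poly (Diword [:: j; i] t [::]) (Diword [:: i; j] t [::])
    (fun m => Diword [:: m] t [::]) (coords x {{i, j}}).

Definition relation_d i j t : D :=
  swap_poly (Diword [::] t [:: j; i]) (Diword [::] t [:: i; j])
    (fun m => Diword [::] t [:: m]) (coords x {{i, j}}).

Lemma gsb_aE i j : 'x_j ⊢ 'x_i - 'x_i ⊣ 'x_j + lin_poly x {{i, j}} =
  relation_a i j.
Proof. by congr (_ - _ + _); [apply: vdash_monomial | apply: dashv_monomial]. Qed.

Lemma gsb_bE i j t :
  'x_j ⊢ 'x_i ⊢ 'x_t - 'x_i ⊢ 'x_j ⊢ 'x_t + lin_poly x {{i, j}} ⊢ 'x_t =
  relation_b i j t.
Proof.
congr (_ - _ + _); [exact: vdash3_monomial | exact: vdash3_monomial |].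
exact: vdash_lincomb_gen.
Qed.

Lemma gsb_dE i j t :
  'x_t ⊣ 'x_j ⊣ 'x_i - 'x_t ⊣ 'x_i ⊣ 'x_j + 'x_t ⊣ lin_poly x {{i, j}} =
  relation_d i j t.
Proof.
congr (_ - _ + _); [exact: dashv3_monomial | exact: dashv3_monomial |].
exact: dashv_lincomb_gen.
Qed.

Lemma gsb_cE p t : 'x_p ⊢ 'x_t = << Diword [:: p] t [::] >>.
Proof. exact: vdash_monomial. Qed.

Lemma gsb_eE p t : 'x_t ⊣ 'x_p = << Diword [::] t [:: p] >>.
Proof. exact: dashv_monomial. Qed.

Lemma deglex_swap (l1 l2 r1 r2 : seq I) t u v i j : (i < j)%O ->
  size l1 = size l2 -> l1 ++ t :: r1 = u ++ i :: j :: v ->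
  l2 ++ t :: r2 = u ++ j :: i :: v ->
  deglex_lt (Diword l1 t r1) (Diword l2 t r2).
Proof.
move=> ij size_l e1 e2; rewrite deglex_ltE /dsize /word /= e1 e2 size_l ltnn eqxx /=.
rewrite !size_cat /= eqxx ltnn /=.
apply: (@seqlexi_cat_lt d I u [:: i; j] [:: j; i] v) => //.
by rewrite Order.SeqLexiOrder.neqhead_ltxiE ?lt_eqF.
Qed.

Lemma monic_at_a i j : monic_at
  (relation_a i j)
  (Diword [:: j] i [::]).
Proof.
by apply: monic_at_swap_poly => [|m]; rewrite deglex_ltE.
Qed.

Lemma monic_at_b i j t : (i < j)%O -> monic_at
  (relation_b i j t) (Diword [:: j; i] t [::]).
Proof.
move=> ij; apply: monic_at_swap_poly => [|m]; last by rewrite deglex_ltE.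
exact: (@deglex_swap _ _ _ _ t [::] [:: t] i j).
Qed.

Lemma monic_at_d i j t : (i < j)%O -> monic_at
  (relation_d i j t) (Diword [::] t [:: j; i]).
Proof.
move=> ij; apply: monic_at_swap_poly => [|m]; last by rewrite deglex_ltE.
exact: (@deglex_swap _ _ _ _ t [:: t] [::] i j).
Qed.

Lemma monic_at_monomial (w : diword I) : monic_at (<< w >> : D) w.
Proof. by move=> v; rewrite subrr msupp0. Qed.

Lemma gsb_d i j t : (i < j)%O -> S (relation_d i j t).
Proof. by move=> ij; rewrite -gsb_dE; apply: GSB_d. Qed.

Lemma gsb_b i j t : (i < j)%O -> S (relation_b i j t).
Proof. by move=> ij; rewrite -gsb_bE; apply: GSB_b. Qed.

Lemma gsb_a i j : S (relation_a i j).
Proof. by rewrite -gsb_aE; apply: GSB_a. Qed.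

Lemma gsb_monic f : S f -> dmonic f.
Proof.
case=> [i j|i j t ij|p t _|i j t ij|p t _].
- by rewrite gsb_aE; apply/monic_at_dmonic/monic_at_a.
- by rewrite gsb_bE; apply/monic_at_dmonic/monic_at_b.
- by rewrite gsb_cE; apply/monic_at_dmonic/monic_at_monomial.
- by rewrite gsb_dE; apply/monic_at_dmonic/monic_at_d.
- by rewrite gsb_eE; apply/monic_at_dmonic/monic_at_monomial.
Qed.

Definition leading_le C s (w : diword I) : Prop :=
  exists2 u, leading s u & deglex_le (fill_diword C u) w.

(* The context which, around the center [last t u], yields the word with
   center [t], the letters [u] before the open position and [v] after it. *)
Definition right_context t u v : dcontext I :=
  if u is i :: u' then RightOfCenter [::] t (belast i u') v else AtCenter [::] v.

Lemma fill_right_context t u v z :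
  fill_diword (right_context t u v) (Diword [::] (last t u) z) =
  Diword [::] t (u ++ z ++ v).
Proof.
rewrite fill_diwordE; case: u => //= i u.
by rewrite -[in RHS]cat_cons (lastI i u) cat_rcons.
Qed.

(** Mirror image of [right_context]: (b) and (c) contain the letter after the rewritten ones, which
    is the center [t] when [v] is empty. *)
Definition left_context t u v : dcontext I :=
  if v is i :: v' then LeftOfCenter u v' t [::] else AtCenter u [::].

Lemma fill_left_context t u v z :
  fill_diword (left_context t u v) (Diword z (head t v) [::]) =
  Diword (u ++ z ++ v) t [::].
Proof.
rewrite fill_diwordE; case: v => [|i v] /=; first by rewrite cats0.
by rewrite /word /= -catA.
Qed.

Lemma right_context_normed t u v s : right_normed s ->
  right_normed (sdiword (right_context t u v) s) ->
  right_normed_sdiword (right_context t u v) s.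
Proof. by case: u => [|i u] rs rC; split. Qed.

Lemma leading_le_right_context t u v z s : monic_at s (Diword [::] (last t u) z) ->
  leading_le (right_context t u v) s (Diword [::] t (u ++ z ++ v)).
Proof.
case/monic_atP=> lead_s _; exists (Diword [::] (last t u) z) => //.
by rewrite fill_right_context; apply: deglex_refl.
Qed.

Lemma left_context_normed t u v s : left_normed s ->
  left_normed (sdiword (left_context t u v) s) ->
  left_normed_sdiword (left_context t u v) s.
Proof. by case: v => [|i v] ls lC; split. Qed.

Lemma leading_le_left_context t u v z s : monic_at s (Diword z (head t v) [::]) ->
  leading_le (left_context t u v) s (Diword (u ++ z ++ v) t [::]).
Proof.
case/monic_atP=> lead_s _; exists (Diword z (head t v) [::]) => //.
by rewrite fill_left_context; apply: deglex_refl.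
Qed.

(** A Lie step right of the center subtracts one S-diword of type (d) or (e). These relations
    contain the letter before the rewritten ones, namely [last t u], which is the center when [u] is
    empty. *)
Lemma right_step t w (h : {malg k[seq I]}) : lie_red x I0 w h -> exists C s,
  [/\ S s, right_normed_sdiword C s, leading_le C s (Diword [::] t w)
    & sdiword C s = << Diword [::] t w >> - lincomb (fun r => << Diword [::] t r >>) h :> D].
Proof.
case=> [u v i j ij|u v p I0p].
  exists (right_context t u v).
  have mon := @monic_at_d i j (last t u) ij.
  have sE : sdiword (right_context t u v) (relation_d i j (last t u)) =
      swap_poly (Diword [::] t (u ++ j :: i :: v)) (Diword [::] t (u ++ i :: j :: v))
        (fun m => Diword [::] t (u ++ m :: v)) (coords x {{i, j}}).
    apply: etrans (sdiword_swap_poly _ _ _ _ _) _.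
    by apply: eq_swap_poly => [||m]; apply: fill_right_context.
  have rn : right_normed (relation_d i j (last t u)) by apply: msupp_swap_poly.
  have rC : right_normed (sdiword (right_context t u v) (relation_d i j (last t u))).
    by rewrite sE; apply: msupp_swap_poly.
  exists (relation_d i j (last t u)); split.
  - exact: gsb_d.
  - exact: right_context_normed rn rC.
  - exact: leading_le_right_context mon.
  - rewrite sE; apply: etrans _ (congr1 (fun f => _ - f) (esym (lincomb_swap _ _ _ _ _))).
    by rewrite /swap_poly opprB addrA addrAC.
exists (right_context t u v), ('x_(last t u) ⊣ 'x_p).
have Ss := @GSB_e k L d I x I0 p (last t u) I0p.
have rn : right_normed ('x_(last t u) ⊣ 'x_p).
  by rewrite gsb_eE => z; rewrite msuppU1_eq => /eqP ->.
have sE : sdiword (right_context t u v) ('x_(last t u) ⊣ 'x_p) =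
    << Diword [::] t (u ++ p :: v) >>.
  by rewrite gsb_eE sdiword_monomial fill_right_context.
have rC : right_normed (sdiword (right_context t u v) ('x_(last t u) ⊣ 'x_p)).
  by rewrite sE => z; rewrite msuppU1_eq => /eqP ->.
split.
- exact: Ss.
- exact: right_context_normed rn rC.
- apply: (@leading_le_right_context t u v [:: p]); rewrite gsb_eE.
  exact: monic_at_monomial.
- by rewrite sE lincomb0r subr0.
Qed.

Lemma left_step t w (h : {malg k[seq I]}) : lie_red x I0 w h -> exists C s,
  [/\ S s, left_normed_sdiword C s, leading_le C s (Diword w t [::])
    & sdiword C s = << Diword w t [::] >> - lincomb (fun l => << Diword l t [::] >>) h :> D].
Proof.
case=> [u v i j ij|u v p I0p].
  exists (left_context t u v).
  have mon := @monic_at_b i j (head t v) ij.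
  have sE : sdiword (left_context t u v) (relation_b i j (head t v)) =
      swap_poly (Diword (u ++ j :: i :: v) t [::]) (Diword (u ++ i :: j :: v) t [::])
        (fun m => Diword (u ++ m :: v) t [::]) (coords x {{i, j}}).
    apply: etrans (sdiword_swap_poly _ _ _ _ _) _.
    by apply: eq_swap_poly => [||m]; apply: fill_left_context.
  have rn : left_normed (relation_b i j (head t v)) by apply: msupp_swap_poly.
  have rC : left_normed (sdiword (left_context t u v) (relation_b i j (head t v))).
    by rewrite sE; apply: msupp_swap_poly.
  exists (relation_b i j (head t v)); split.
  - exact: gsb_b.
  - exact: left_context_normed rn rC.
  - exact: leading_le_left_context mon.
  - rewrite sE; apply: etrans _ (congr1 (fun f => _ - f) (esym (lincomb_swap _ _ _ _ _))).
    by rewrite /swap_poly opprB addrA addrAC.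
exists (left_context t u v), ('x_p ⊢ 'x_(head t v)).
have Ss := @GSB_c k L d I x I0 p (head t v) I0p.
have rn : left_normed ('x_p ⊢ 'x_(head t v)).
  by rewrite gsb_cE => z; rewrite msuppU1_eq => /eqP ->.
have sE : sdiword (left_context t u v) ('x_p ⊢ 'x_(head t v)) =
    << Diword (u ++ p :: v) t [::] >>.
  by rewrite gsb_cE sdiword_monomial fill_left_context.
have rC : left_normed (sdiword (left_context t u v) ('x_p ⊢ 'x_(head t v))).
  by rewrite sE => z; rewrite msuppU1_eq => /eqP ->.
split.
- exact: Ss.
- exact: left_context_normed rn rC.
- apply: (@leading_le_left_context t u v [:: p]); rewrite gsb_cE.
  exact: monic_at_monomial.
- by rewrite sE lincomb0r subr0.
Qed.

End Reduction.

Arguments relation_a {k L d I} x i j.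
Arguments relation_b {k L d I} x i j t.
Arguments relation_d {k L d I} x i j t.

(** Bookkeeping for one use of (a): [v] is the diword, [v'] and [e] are its swapped and bracket
    terms, [n'] and [n] their normal forms. *)
Lemma telescoping_reduction (V : zmodType) (v v' e n' n : V) :
  v - (n' - n) = v - v' + e + (v' - n') - (e - n).
Proof.
rewrite [_ + e + _]addrAC subrKA -[RHS]addrA !opprB [e + _]addrC subrK.
by rewrite addrA addrAC.
Qed.

Section NormalForm.
Context {k : fieldType} {L : leibnizType k} {d : Order.disp_t} {I : orderType d}.
Context {x : I -> L} {I0 : set I}.
Context (x_basis : is_basis [set: I] x [set: L]).
Context (x_basis0 : is_basis I0 x (leibniz_kernel L)).
Local Notation D := (free_dialg k I).
Local Notation S := (enveloping_gsb x I0).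
Local Notation "{{ i , j }}" := (bracket (x i) (x j)).
Local Notation "''x_' i" := (gen k i) (at level 8, i at level 2).
Local Notation nf := (lie_nf x I0).
Local Notation mu := (@word_measure d I).
Implicit Types (i j t m p : I) (a b : L) (f g h s : D) (u v w r l : seq I).
Implicit Types (C : dcontext I).

Lemma lie_red_le w (h : {malg k[seq I]}) t : lie_red x I0 w h -> forall v, v \in msupp h ->
  deglex_le (Diword [::] t v) (Diword [::] t w) /\
  deglex_le (Diword v t [::]) (Diword w t [::]).
Proof.
case=> [u v i j ij|u v p _]; last by move=> ?; rewrite msupp0.
have Pl := msupp_closed (k := k) (fun w' =>
  deglex_le (Diword [::] t w') (Diword [::] t (u ++ j :: i :: v)) /\
  deglex_le (Diword w' t [::]) (Diword (u ++ j :: i :: v) t [::])).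
apply: (lin_closedB Pl) => [w'|].
  rewrite msuppU1_eq => /eqP ->; split; apply: deglex_ltW.
    exact: (@deglex_swap _ _ [::] [::] (u ++ i :: j :: v) (u ++ j :: i :: v) t (t :: u) v i j).
  apply: (@deglex_swap _ _ _ _ [::] [::] t u (v ++ [:: t]) i j) => //; rewrite -?catA //.
  by rewrite !size_cat.
apply: (lin_closed_lincomb Pl) => m _ w'; rewrite msuppU1_eq => /eqP ->.
by split; apply/deglex_ltW/deglex_lt_dsize; rewrite !dsizeE /= !size_cat /=; lia.
Qed.

Lemma right_reduction t w :
  sum_of_sdiwords S
    (fun C s => right_normed_sdiword C s /\ leading_le C s (Diword [::] t w))
    ((<< Diword [::] t w >> : D) - lincomb (fun r => << Diword [::] t r >> : D) (nf w)).
Proof.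
apply: (nf_reduction (@lie_red_mu k L d I x I0)
  (le := fun v w => deglex_le (Diword [::] t v) (Diword [::] t w))
  (F := fun r => << Diword [::] t r >> : D)).
- by move=> v; apply: deglex_refl.
- by move=> v u z; apply: deglex_le_trans.
- by move=> v h rh u uh; case: (lie_red_le t rh uh).
- exact: sum_of_sdiwords_closed.
move=> v h rh le_vw; have [C [s [Ss Cs [z sz le_z] <-]]] := right_step t rh.
apply: sum_of_sdiwords1 => //; split=> //; exists z => //.
exact: deglex_le_trans le_z le_vw.
Qed.

Lemma left_reduction t w :
  sum_of_sdiwords S
    (fun C s => left_normed_sdiword C s /\ leading_le C s (Diword w t [::]))
    ((<< Diword w t [::] >> : D) - lincomb (fun l => << Diword l t [::] >> : D) (nf w)).
Proof.
apply: (nf_reduction (@lie_red_mu k L d I x I0)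
  (le := fun v w => deglex_le (Diword v t [::]) (Diword w t [::]))
  (F := fun l => << Diword l t [::] >> : D)).
- by move=> v; apply: deglex_refl.
- by move=> v u z; apply: deglex_le_trans.
- by move=> v h rh u uh; case: (lie_red_le t rh uh).
- exact: sum_of_sdiwords_closed.
move=> v h rh le_vw; have [C [s [Ss Cs [z sz le_z] <-]]] := left_step t rh.
apply: sum_of_sdiwords1 => //; split=> //; exists z => //.
exact: deglex_le_trans le_z le_vw.
Qed.

Lemma lie_nf_functional : lie_functional x I0 nf.
Proof.
split=> [u v i j|u v p I0p].
  (* A bound above both words, since the larger one depends on the order of [i] and [j]. *)
  pose n := (mu (u ++ j :: i :: v) + mu (u ++ i :: j :: v)).+1.
  have resp : respects (lie_red x I0) mu nf n by apply: lie_nf_respects.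
  apply: (respects_swap x_basis x_basis0 resp).
    by rewrite /n ltnS leq_addr.
  by rewrite /n ltnS leq_addl.
have resp : respects (lie_red x I0) mu nf (mu (u ++ p :: v)).+1 by apply: lie_nf_respects.
by have := respects_kill resp I0p (ltnSn _).
Qed.

Lemma lie_functional_comp (U V : lmodType k) (F : seq I -> U) (f : U -> V) : linear f ->
  lie_functional x I0 F -> lie_functional x I0 (fun w => f (F w)).
Proof.
move=> fl [Fs Fk]; split=> [u v i j|u v p I0p]; last by rewrite Fk // linearP0.
by rewrite Fs linearPB // /insert linearP_lincomb.
Qed.

Definition normal_functional a r : D :=
  lincomb (fun m => lincomb (fun z => << Diword [::] m z >> : D) (nf r)) (coords x a).

Lemma normal_functional_tensor : tensor_functional x I0 normal_functional.
Proof.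
split=> [r|a]; first exact: coords_lincomb_linear.
have -> : normal_functional a = fun r =>
    lincomb (fun z => lincomb (fun m => << Diword [::] m z >> : D) (coords x a)) (nf r).
  by apply/funext => r; apply: lincomb_exchange.
exact: lie_functional_comp (lincomb_linear _) lie_nf_functional.
Qed.

(* Defined on the model of U(L), and not by a reduction strategy, it vanishes on
   the ideal. *)
Definition normal_form : diword I -> D := diword_functional x normal_functional.

Lemma normal_form_right t w :
  normal_form (Diword [::] t w) = lincomb (fun z => << Diword [::] t z >>) (nf w).
Proof.
rewrite /normal_form /diword_functional /= /normal_functional.
by rewrite (coords_basis x_basis) lincombU1.
Qed.

(** Relation (a) as a rule moving the letter next to the center to its right; this letter is the
    last one transposed by [act]. *)
Lemma normal_form_rcons l j i r :
  normal_form (Diword (rcons l j) i r) = normal_form (Diword l i (j :: r)) -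
    lincomb (fun m => normal_form (Diword l m r)) (coords x {{i, j}}).
Proof.
rewrite /normal_form /diword_functional /= -cats1 act_cat /= /shift; congr (_ - _).
have [al _] := tensor_functional_act l normal_functional_tensor.
by have := linearP_lincomb x (coords x {{i, j}}) (al r); rewrite (coordsK x_basis) => /= ->.
Qed.

Lemma normal_form_kernel f : Id S f -> lincomb normal_form f = 0.
Proof.
rewrite -(Id_relations_gsb x_basis x_basis0).
move=> /(relations_functional_kernel x_basis x_basis0 D)[+ _].
by apply; apply: normal_functional_tensor.
Qed.

(** Induction on the number of letters left of the center. Each is moved by an S-diword of type (a),
    normal because its open position is the center; once none is left, [right_reduction] applies. *)
Lemma normal_reduction (w : diword I) :
  sum_of_sdiwords S (fun C s => normal C s /\ leading_le C s w)
    ((<< w >> : D) - normal_form w).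
Proof.
case: w => l t w; have [n] := ubnP (size l); elim: n l t w => // n IH l t w.
have Sl (v : diword I) := sum_of_sdiwords_closed S (fun C s => normal C s /\ leading_le C s v).
case/lastP: l => [_|l j].
  rewrite normal_form_right; apply: sum_of_sdiwordsS (right_reduction t w).
  by move=> C s _ [[]].
rewrite size_rcons ltnS => lt_n; rewrite normal_form_rcons.
(* Covers both terms produced by (a): the swapped one keeps the length but has fewer letters left of
   the center, the bracket terms are shorter. *)
have lt_w m v : (size v <= (size w).+1)%N ->
    deglex_le (Diword l m v) (Diword (rcons l j) t w).
  move=> le_v; apply: deglex_ltW; rewrite deglex_ltE !dsizeE /= size_rcons ltnSn /= andbT.
  by rewrite orbC -leq_eqVlt; lia.
have step : sdiword (AtCenter l w) (relation_a x t j) =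
    swap_poly (Diword (rcons l j) t w) (Diword l t (j :: w)) (fun m => Diword l m w)
      (coords x {{t, j}}).
  apply: etrans (sdiword_swap_poly _ _ _ _ _) _.
  by apply: eq_swap_poly => [||m]; rewrite fill_diwordE /= ?cats1 ?cats0.
have lead : leading_le (AtCenter l w) (relation_a x t j) (Diword (rcons l j) t w).
  have /monic_atP[lead_a _] := @monic_at_a k L d I x t j.
  exists (Diword [:: j] t [::]); first exact: lead_a.
  by rewrite fill_diwordE /= cats1; apply: deglex_refl.
have Pa : sum_of_sdiwords S
    (fun C s => normal C s /\ leading_le C s (Diword (rcons l j) t w))
    (sdiword (AtCenter l w) (relation_a x t j)).
  by apply: sum_of_sdiwords1; [apply: gsb_a | split].
have Pw m v : (size v <= (size w).+1)%N -> sum_of_sdiwords S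
    (fun C s => normal C s /\ leading_le C s (Diword (rcons l j) t w))
    ((<< Diword l m v >> : D) - normal_form (Diword l m v)).
  move=> le_v; apply: sum_of_sdiwordsS (IH l m v lt_n) => C s _ [nC [z sz le_z]].
  by split=> //; exists z => //; apply: deglex_le_trans le_z (lt_w m v le_v).
rewrite (telescoping_reduction _ (<< Diword l t (j :: w) >> : D)
  (lincomb (fun m => << Diword l m w >> : D) (coords x {{t, j}}))).
apply: (lin_closedB (Sl _)); first apply: (lin_closedD (Sl _)).
- by rewrite -[X in sum_of_sdiwords _ _ X]step.
- by apply: Pw.
- rewrite -[X in sum_of_sdiwords _ _ X]lincombBl.
  by apply: (lin_closed_lincomb (Sl _)) => m _; apply: Pw.
Qed.

End NormalForm.

Lemma swap_term (V : zmodType) (v v' e : V) : v' = v + e - (v - v' + e).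
Proof. by rewrite opprD addrACA subrr addr0 opprB addrC subrK. Qed.

(** * Triviality of the compositions and the basis *)
Section Compositions.
Context {k : fieldType} {L : leibnizType k} {d : Order.disp_t} {I : orderType d}.
Context {x : I -> L} {I0 : set I}.
Context (x_basis : is_basis [set: I] x [set: L]).
Context (x_basis0 : is_basis I0 x (leibniz_kernel L)).
Local Notation D := (free_dialg k I).
Local Notation S := (enveloping_gsb x I0).
Local Notation "{{ i , j }}" := (bracket (x i) (x j)).
Local Notation "''x_' i" := (gen k i) (at level 8, i at level 2).
Local Notation nf := (lie_nf x I0).
Local Notation normal_form := (@normal_form k L d I x I0).
Implicit Types (i j t m p : I) (a b : L) (f g h s : D) (u v r l : seq I) (w : diword I).
Implicit Types (C : dcontext I).

(** The value 0 off the left normed diwords makes this a map on all of D(X). It is only claimed to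
    vanish on S-diwords of left normed elements and on f ⊢ x with f in the ideal. *)
Definition left_form w : D :=
  if dright w is [::] then lincomb (fun l => << Diword l (dcenter w) [::] >> : D) (nf (dleft w))
  else 0.

Lemma left_form_reduction w : dright w = [::] ->
  sum_of_sdiwords S (fun C s => left_normed_sdiword C s /\ leading_le C s w)
    ((<< w >> : D) - left_form w).
Proof. by case: w => l t r /= ->; apply: left_reduction. Qed.

Lemma left_form_functional u v t r :
  lie_functional x I0 (fun z => left_form (Diword (u ++ z ++ v) t r)).
Proof.
case: r => [|i r]; last first.
  by split=> *; rewrite /left_form /= ?subr0 ?subrr ?/insert ?lincomb0 ?subr0.
have nf_uv := lie_functional_cat u v (lie_nf_functional x_basis x_basis0).
exact: lie_functional_comp (lincomb_linear (fun l => << Diword l t [::] >> : D)) nf_uv.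
Qed.

(** The center [t] of a filled-in relation of type (b) or (c) stays the center or becomes an
    ordinary letter; to the right of the center of [C] everything is sent to 0. *)
Lemma left_form_fill C t : lie_functional x I0
  (fun z => left_form (fill_diword C (Diword z t [::]))).
Proof.
have ext F F' : F =1 F' -> lie_functional x I0 F -> lie_functional (V := D) x I0 F'.
  by move=> /funext ->.
case: C => [a b|a a' c b|a c b' b].
- apply: ext (left_form_functional a [::] t b) => z.
  by rewrite fill_diwordE /= cats0.
- apply: ext (left_form_functional a (t :: a') c b) => z.
  by rewrite fill_diwordE /word /= -catA.
- have zero z : left_form (fill_diword (RightOfCenter a c b' b) (Diword z t [::])) = 0.
    rewrite fill_diwordE /word /left_form /=.
    by case: (b') => //=; case: (z).
  split=> [u v i j|u v p _]; rewrite !zero // /insert.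
  by under eq_lincomb do rewrite zero; rewrite lincomb0 subrr.
Qed.

Lemma left_normed_closed : lin_closed (fun f : D => left_normed f).
Proof. exact: msupp_closed. Qed.

Lemma left_normed_monomial w : left_normed (<< w >> : D) <-> dright w = [::].
Proof.
split=> [|rw v]; first by apply; rewrite msuppU1_eq.
by rewrite msuppU1_eq => /eqP ->.
Qed.

Lemma gsb_left_normed f : S f -> left_normed f ->
  (exists i j t, (i < j)%O /\ f = relation_b x i j t) \/
  (exists p t, I0 p /\ f = << Diword [:: p] t [::] >>).
Proof.
case=> [i j|i j t ij|p t I0p|i j t ij|p t I0p].
- rewrite gsb_aE => lf; exfalso.
  (* Were (a) left normed, its term x_i ⊣ x_j would be a combination of left normed polynomials; no
     coefficient has to be computed. *)
  suff /left_normed_monomial : left_normed (<< Diword [::] i [:: j] >> : D) by [].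
  have -> : (<< Diword [::] i [:: j] >> : D) =
      << Diword [:: j] i [::] >> + lincomb (fun m => << letter m >> : D) (coords x {{i, j}})
      - relation_a x i j.
    exact: swap_term.
  apply: (lin_closedB left_normed_closed) lf.
  apply: (lin_closedD left_normed_closed); first exact/left_normed_monomial.
  by apply: (lin_closed_lincomb left_normed_closed) => m _; apply/left_normed_monomial.
- by rewrite gsb_bE => _; left; exists i, j, t.
- by rewrite gsb_cE => _; right; exists p, t.
- rewrite gsb_dE => lf; have /monic_atP[[lead _] _] := @monic_at_d k L d I x i j t ij.
  by have := lf _ lead.
- by rewrite gsb_eE => /left_normed_monomial.
Qed.

Lemma gsb_not_both_normed f : S f -> left_normed f -> right_normed f -> False.
Proof.
move=> Sf lf rf; have [[i [j [t [ij def_f]]]]|[p [t [_ def_f]]]] := gsb_left_normed Sf lf.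
  have /monic_atP[[lead _] _] := @monic_at_b k L d I x i j t ij.
  by rewrite -def_f in lead; have := rf _ lead.
have : Diword [:: p] t [::] \in msupp f by rewrite def_f msuppU1_eq.
by move/rf.
Qed.

Lemma left_form_sdiword C s : S s -> left_normed s -> lincomb left_form (sdiword C s) = 0.
Proof.
move=> Ss ls; have [[i [j [t [ij ->]]]]|[p [t [I0p ->]]]] := gsb_left_normed Ss ls.
  have [swap _] := left_form_fill C t.
  rewrite [X in lincomb _ X]sdiword_swap_poly lincomb_swap_poly.
  have := swap [::] [::] i j; rewrite /= /insert /= => ->.
  by rewrite addrAC subrK subrr.
have [_ kill] := left_form_fill C t.
by rewrite sdiword_monomial lincombU1; apply: (kill [::] [::] p I0p).
Qed.

(** In f ⊢ x_t only the words of f survive, so the second condition of [functional_kernel]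
    applies. *)
Lemma left_form_vdash f t : Id S f -> lincomb left_form (f ⊢ 'x_t) = 0.
Proof.
rewrite -(Id_relations_gsb x_basis x_basis0).
move=> /(relations_functional_kernel x_basis x_basis0 D)[_ fk].
rewrite lincomb_bilin -[RHS](fk _ (left_form_functional [::] [::] t [::])).
by apply: eq_lincomb => w _; rewrite lincombU1.
Qed.

Lemma Id_sdiword C s : S s -> Id S (sdiword C s).
Proof.
by move=> Ss; apply: (ideal_sdiword C (Id_ideal S)); apply: sub_gen_smallest.
Qed.

Lemma Id_closed (T : set D) : lin_closed (Id T).
Proof. by have [? ? _] := Id_ideal T; split. Qed.

Lemma Id_sum_of_sdiwords P f : sum_of_sdiwords S P f -> Id S f.
Proof.
move=> [n [t [C [s [SP ->]]]]]; have IS := Id_closed S.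
elim/big_ind: _ => [|f1 f2 If1 If2|i _]; first exact: IS.1.
  exact: (lin_closedD IS).
rewrite -[X in Id S X]addr0; apply: IS.2; last exact: IS.1.
by apply: Id_sdiword; case: (SP i).
Qed.

Lemma sum_of_reductions (T : diword I -> D) (P : diword I -> dcontext I -> D -> Prop)
    (Q : dcontext I -> D -> Prop) h :
  lincomb T h = 0 ->
  (forall w, w \in msupp h -> sum_of_sdiwords S (P w) ((<< w >> : D) - T w)) ->
  (forall w C s, w \in msupp h -> P w C s -> Q C s) -> sum_of_sdiwords S Q h.
Proof.
move=> Th PT PQ; have hE : h = lincomb (fun w => (<< w >> : D) - T w) h.
  by rewrite lincombBl Th subr0; apply/esym; apply: lincomb_id.
rewrite [X in sum_of_sdiwords _ _ X]hE.
apply: (lin_closed_lincomb (sum_of_sdiwords_closed S Q)) => w wh.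
by apply: sum_of_sdiwordsS (PT w wh) => C s _; apply: PQ.
Qed.

Lemma leading_le_lt C s w w' : leading_le C s w -> deglex_lt w w' -> leading_lt C s w'.
Proof. by move=> [u su le_u] lt_w; exists u => //; apply: deglex_le_lt_trans le_u lt_w. Qed.

Lemma leading_le_size C s w h : leading_le C s w -> w \in msupp h -> leading_size_le C s h.
Proof.
move=> [u su le_u] wh; have [|z hz] := @leading_exists d I k h.
  by apply/eqP => h0; rewrite h0 msupp0 in wh.
exists u, z; split=> //; apply: leq_trans (deglex_dsize le_u) _.
by apply: deglex_dsize; apply: hz.2.
Qed.

Lemma right_normed_reduction w : dleft w = [::] ->
  sum_of_sdiwords S (fun C s => right_normed_sdiword C s /\ leading_le C s w)
    ((<< w >> : D) - normal_form w).
Proof.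
case: w => l t r /= ->; rewrite (normal_form_right x_basis).
exact: right_reduction.
Qed.

(** Inclusion and intersection at once: both are differences of two normal S-diwords with the same
    leading diword [w]; for inclusion [B] is the empty context. *)
Lemma composition_trivial f g (B A : dcontext I) (w u v : diword I) :
  S f -> S g -> leading f u -> leading g v ->
  normal B f -> normal A g -> w = fill_diword B u -> w = fill_diword A v ->
  trivial_mod S w
    (right_normed_sdiword B f /\ right_normed_sdiword A g)
    (left_normed_sdiword B f /\ left_normed_sdiword A g)
    (sdiword B f - sdiword A g).
Proof.
move=> Sf Sg fu gv nB nA wB wA.
have lt_w : forall z, z \in msupp (sdiword B f - sdiword A g) -> deglex_lt z w.
  apply: monic_at_sub.
    rewrite wB; apply: monic_at_sdiword => //; first by case: fu.
    exact: dmonic_at (gsb_monic Sf) fu.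
  rewrite wA; apply: monic_at_sdiword => //; first by case: gv.
  exact: dmonic_at (gsb_monic Sg) gv.
have [[lB lA]|notL] := pselect (left_normed_sdiword B f /\ left_normed_sdiword A g).
  apply: (sum_of_reductions (T := left_form)
    (P := fun w C s => left_normed_sdiword C s /\ leading_le C s w)).
  - by rewrite free_lincombB !left_form_sdiword ?subrr //; [case: lA | case: lB].
  - move=> z zh; apply: left_form_reduction.
    by apply: (lin_closedB left_normed_closed) zh; [case: lB | case: lA].
  move=> z C s zh [lC le_z]; split=> //; first by case: lC.
    exact: leading_le_lt le_z (lt_w z zh).
  (* The right normed requirement is vacuous here, as no element of S is normed on both sides. *)
  by move=> [[_ rf _] _]; case: (gsb_not_both_normed Sf) => //; case: lB.
have nf_h : lincomb normal_form (sdiword B f - sdiword A g) = 0.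
  apply: (normal_form_kernel x_basis x_basis0).
  by apply: (lin_closedB (Id_closed S)); apply: Id_sdiword.
have [[rB rA]|notR] := pselect (right_normed_sdiword B f /\ right_normed_sdiword A g).
  apply: (sum_of_reductions (T := normal_form)
    (P := fun w C s => right_normed_sdiword C s /\ leading_le C s w)) => //.
    move=> z zh; apply: right_normed_reduction.
    have Rl : lin_closed (fun f : D => right_normed f) by apply: msupp_closed.
    by apply: (lin_closedB Rl) zh; [case: rB | case: rA].
  move=> z C s zh [rC le_z]; split=> //; first by case: rC.
  exact: leading_le_lt le_z (lt_w z zh).
apply: (sum_of_reductions (T := normal_form)
  (P := fun w C s => normal C s /\ leading_le C s w)) => //.
  by move=> z _; apply: normal_reduction.
move=> z C s zh [nC le_z]; split=> //.
exact: leading_le_lt le_z (lt_w z zh).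
Qed.

Lemma gsb_left_mult_trivial : left_mult_trivial S.
Proof.
move=> f t Sf _; set h := 'x_t ⊣ f.
have Ih : Id S h.
  by have [_ _ /(_ f 'x_t)[]] := Id_ideal S; first exact: sub_gen_smallest.
apply: (sum_of_reductions (T := normal_form)
  (P := fun w C s => right_normed_sdiword C s /\ leading_le C s w)).
- exact: (normal_form_kernel x_basis x_basis0).
(* Multiplying by a letter with ⊣ puts the center first whatever f is, so the reductions stay right
   normed. *)
- have rh : right_normed h.
    have -> : h = lincomb (fun w => << diword_dashv (letter t) w >> : D) f.
      rewrite /h (free_linearE f (dashv_linearr 'x_t)); apply: eq_lincomb => w _.
      exact: dashv_monomial.
    have Rl : lin_closed (fun f : D => right_normed f) by apply: msupp_closed.
    by apply: (lin_closed_lincomb Rl) => w _ z; rewrite msuppU1_eq => /eqP ->.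
  by move=> w /rh; apply: right_normed_reduction.
- by move=> w C s wh [rC le_w]; split=> //; apply: leading_le_size le_w wh.
Qed.

Lemma gsb_right_mult_trivial : right_mult_trivial S.
Proof.
move=> f t Sf _; set h := f ⊢ 'x_t.
apply: (sum_of_reductions (T := left_form)
  (P := fun w C s => left_normed_sdiword C s /\ leading_le C s w)).
- by apply: left_form_vdash; apply: sub_gen_smallest.
- have lh : left_normed h.
    have -> : h = lincomb (fun w => << diword_vdash w (letter t) >> : D) f.
      rewrite /h (free_linearE f (vdash_linearl 'x_t)); apply: eq_lincomb => w _.
      exact: vdash_monomial.
    by apply: (lin_closed_lincomb left_normed_closed) => w _; apply/left_normed_monomial.
  by move=> w /lh; apply: left_form_reduction.
- by move=> w C s wh [lC le_w]; split=> //; apply: leading_le_size le_w wh.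
Qed.

Lemma gsb_inclusion_trivial : inclusion_trivial S.
Proof.
move=> f g w v C Sf Sg fw gv wC nC.
have wE : w = fill_diword (AtCenter [::] [::]) w.
  by rewrite fill_diwordE; case: (w) => ? ? ?; rewrite /= cats0.
apply: sum_of_sdiwordsS
  (@composition_trivial f g (AtCenter [::] [::]) C w w v Sf Sg fw gv Logic.I nC wE wC).
by move=> A s _ [nA lt_s Rs Ls]; split=> // -[nf_f Cg];
  [apply: Rs | apply: Ls]; split=> //; split.
Qed.

Lemma gsb_intersection_trivial : intersection_trivial S.
Proof.
move=> f g w u v B A Sf Sg fu gv _ _ wB wA _ nB nA.
exact: (composition_trivial Sf Sg fu gv nB nA wB wA).
Qed.

Lemma enveloping_gsb_groebner_shirshov : groebner_shirshov_basis S.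
Proof.
split.
- by move=> f; apply: gsb_monic.
- by split; [apply: gsb_left_mult_trivial | apply: gsb_right_mult_trivial].
- exact: gsb_inclusion_trivial.
- exact: gsb_intersection_trivial.
Qed.

End Compositions.

(** * The basis of U(L) and the embedding of L *)

Section PBW.
Context {k : fieldType} {L : leibnizType k} {d : Order.disp_t} {I : orderType d}.
Context {x : I -> L} {I0 : set I}.
Context (x_basis : is_basis [set: I] x [set: L]).
Context (x_basis0 : is_basis I0 x (leibniz_kernel L)).
Local Notation D := (free_dialg k I).
Local Notation S := (enveloping_gsb x I0).
Local Notation U := (enveloping x).
Local Notation pi := (enveloping_pi x).
Local Notation nf := (lie_nf x I0).
Local Notation normal_form := (@normal_form k L d I x I0).

Definition pbw_word (p : I * seq I) : D := << Diword [::] p.1 p.2 >>.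

Lemma pbw_monomialE p : pbw_monomial x p = pi (pbw_word p).
Proof.
case: p => j r; have fillE : fill_diword (AtCenter [::] r) (letter j) = Diword [::] j r.
  by rewrite fill_diwordE.
rewrite /pbw_word -[Diword _ _ _]fillE -[X in pi X]sdiword_monomial.
apply: etrans _ (morphism_foldl (pi_dashv (x := x)) (map (@gen k I) r) (gen k j)).
by rewrite /pbw_monomial /dichain -map_comp.
Qed.

Lemma lincomb_pbw_monomial c : lincomb (pbw_monomial x) c = pi (lincomb pbw_word c).
Proof.
rewrite (linearP_lincomb pbw_word c (pi_linear (x := x))).
by apply: eq_lincomb => p _; apply: pbw_monomialE.
Qed.

Lemma normal_form_pbw_word p : pbw_index I0 p ->
  normal_form (Diword [::] p.1 p.2) = pbw_word p.
Proof.
move=> [p_sorted pI0]; rewrite (normal_form_right x_basis) lie_nf_normal //.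
exact: lincombU1.
Qed.

Definition pbw_span : set D := lin_span (pbw_index I0) pbw_word.

Lemma pbw_span_closed : lin_closed pbw_span.
Proof.
split=> [|t f g [cf Cf <-] [cg Cg <-]].
  by exists 0; [move=> p; rewrite msupp0 | apply: lincomb0r].
by exists (t *: cf + cg); [apply: (msupp_closed _).2 | apply: lincomb_linear].
Qed.

Lemma normal_form_span w : pbw_span (normal_form w).
Proof.
rewrite /normal_form /diword_functional.
have act_span q : (forall a r, pbw_span (q a r)) ->
    forall l a r, pbw_span (act (x := x) q l a r).
  move=> qs l; elim: l q qs => //= j l IH q qs; apply: IH => a r.
  exact: (lin_closedB pbw_span_closed).
apply: act_span => a r; apply: (lin_closed_lincomb pbw_span_closed) => m _.
apply: (lin_closed_lincomb pbw_span_closed) => z zr.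
exists << (m, z) >>; last exact: lincombU1.
move=> p; rewrite msuppU1_eq => /eqP ->.
exact: lie_nf_supp zr.
Qed.

Lemma pi_normal_form f : pi f = pi (lincomb normal_form f).
Proof.
apply/eqP; rewrite -subr_eq0 -(linearPB (pi_linear (x := x))); apply/eqP/pi_eq0.
rewrite (Id_relations_gsb x_basis x_basis0).
have -> : f - lincomb normal_form f = lincomb (fun w => (<< w >> : D) - normal_form w) f.
  by rewrite lincombBl; congr (_ - _); apply/esym/lincomb_id.
apply: (lin_closed_lincomb (Id_closed S)) => w _.
exact: Id_sum_of_sdiwords (normal_reduction x_basis x_basis0 w).
Qed.

Lemma lincomb_pbw_word_inj c : lincomb pbw_word c = 0 -> c = 0.
Proof.
move=> c0; rewrite -(lincomb_id c).
have -> : lincomb (fun p => << p >>) c =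
    lincomb (fun w : diword I => << (dcenter w, dright w) >> : {malg k[(I * seq I)%type]})
      (lincomb pbw_word c).
  rewrite free_lincomb_lincomb; apply: eq_lincomb => -[j r] _.
  by rewrite /pbw_word lincombU1.
by rewrite c0; apply: lincomb0r.
Qed.

(** Independence: [normal_form] fixes the basis diwords and vanishes on the ideal. Spanning: modulo
    the ideal each polynomial equals its normal form. *)
Lemma pbw_basis : is_basis (pbw_index I0) (pbw_monomial x) [set: U].
Proof.
split=> [c c_index|].
  rewrite lincomb_pbw_monomial => /pi_eq0.
  rewrite (Id_relations_gsb x_basis x_basis0).
  move/(normal_form_kernel x_basis x_basis0); rewrite free_lincomb_lincomb => c0.
  apply: lincomb_pbw_word_inj; rewrite -[RHS]c0; apply: eq_lincomb => p /c_index pI.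
  by rewrite /pbw_word lincombU1 normal_form_pbw_word.
rewrite eqEsubset; split=> // y _.
have [f ->] : exists f : D, y = pi f.
  by exists (dialg_repr y); apply/esym/dialg_reprK.
rewrite pi_normal_form.
have [c c_index <-] := lin_closed_lincomb (c := f) pbw_span_closed
  (fun w _ => normal_form_span w).
by exists c => //; apply: lincomb_pbw_monomial.
Qed.

Lemma enveloping_map_morphism : leibniz_morphism (enveloping_map x).
Proof.
split=> [|a b]; first exact: (enveloping_vec_linear x_basis).
exact: (enveloping_vec_bracket x_basis).
Qed.

(** A single letter has nothing right of its center, so it is its own normal form even when its
    index lies in [I0]. *)
Lemma enveloping_map_inj : injective (enveloping_map x).
Proof.
move=> a b eq_ab; apply/eqP; rewrite -subr_eq0; apply/eqP.
have /pi_eq0 : pi (lin_poly x (a - b)) = 0.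
  apply: etrans (linearPB (enveloping_vec_linear x_basis) a b) _.
  by apply/eqP; rewrite subr_eq0; apply/eqP.
rewrite (Id_relations_gsb x_basis x_basis0) => /(normal_form_kernel x_basis x_basis0).
rewrite lincomb_lin_poly => c0; rewrite -(coordsK x_basis (a - b)).
suff -> : coords x (a - b) = 0 by rewrite lincomb0r.
have -> : coords x (a - b) = lincomb (fun w : diword I => << dcenter w >>)
    (lincomb (fun m => normal_form (letter m)) (coords x (a - b))).
  rewrite free_lincomb_lincomb -{1}(lincomb_id (coords x (a - b))).
  apply: eq_lincomb => m _.
  have nf_m : normal_form (letter m) = << letter m >>.
    by apply: (@normal_form_pbw_word (m, [::])); split.
  by rewrite nf_m lincombU1.
by rewrite c0; apply: lincomb0r.
Qed.

Lemma enveloping_map_basis i : enveloping_map x (x i) = pi (gen k i).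
Proof. exact: enveloping_vec_basis. Qed.

End PBW.

Theorem theorem4p3 (k : fieldType) (L : leibnizType k)
    (d : Order.disp_t) (I : orderType d) (x : I -> L) (I0 : set I)
    (I_wo : well_order (<=%O : rel I))
    (x_basis : is_basis [set: I] x [set: L])
    (x_basis0 : is_basis I0 x (leibniz_kernel L)) :
  [/\ Id (enveloping_relations x) = Id (enveloping_gsb x I0),
      groebner_shirshov_basis (enveloping_gsb x I0),
      is_basis (pbw_index I0) (pbw_monomial x) [set: enveloping x]
    & [/\ leibniz_morphism (enveloping_map x),
          injective (enveloping_map x)
        & forall i, enveloping_map x (x i) = enveloping_pi x (gen k i)]].
Proof.
split.
- exact: Id_relations_gsb x_basis x_basis0.
- exact: enveloping_gsb_groebner_shirshov x_basis x_basis0.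
- exact: pbw_basis x_basis x_basis0.
- split; first exact: enveloping_map_morphism x_basis.
    exact: enveloping_map_inj x_basis x_basis0.
  exact: enveloping_map_basis x_basis.
Qed.
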